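(* Let $p$ be a prime and $N\geq1$. A dephased matrix $H\in M_{3\times N}(\mathbb Z_p)$ with multiplicity matrix $A\in M_p(\mathbb N)$ is partial Butson if and only if $A$ is tristochastic with sum $N/p$; thus the dephased partial Butson matrices $H\in M_{3\times N}(\mathbb Z_p)$, up to permutation of the columns, are indexed by the tristochastic matrices $A\in M_p(\mathbb N)$ with sum $N/p$. In particular, for $p=3$, the probability $P_3$ for a uniformly random matrix $H\in M_{3\times N}(\mathbb Z_3)$ to be partial Butson satisfies $$P_3\simeq\frac{243\sqrt{3}}{(2\pi N)^3}$$ in the $N\in3\mathbb N$, $N\to\infty$ limit.
   Context: $\mathbb N=\{0,1,2,\ldots\}$. $\mathbb Z_p\subset\mathbb C^\times$ denotes the multiplicative group of complex $p$-th roots of unity, $w=e^{2\pi i/p}$, and $M_{M\times N}(\mathbb Z_p)$ is the set of $M\times N$ matrices with entries in $\mathbb Z_p$. A matrix $H\in M_{M\times N}(\mathbb Z_p)$ is partial Butson if its rows are pairwise orthogonal in $\mathbb C^N$ with the usual Hermitian scalar product. It is dephased if its first row consists of $1$ entries only. The multiplicity matrix $A\in M_p(\mathbb N)$ of a dephased $H\in M_{3\times N}(\mathbb Z_p)$ is given by: $A_{ij}$ ($1\leq i,j\leq p$) is the number of columns of $H$ equal to $(1,w^{i-1},w^{j-1})^t$. A matrix $A\in M_p(\mathbb N)$ is tristochastic if the sums on its rows, on its columns and on its diagonals are all equal; their common value is called the sum of $A$. Here the diagonals are the main diagonal and its $p-1$ translates to the right, i.e. for each $c\in\mathbb Z/p\mathbb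 Z$ the set of positions $(i,j)$ with $j-i\equiv c$ modulo $p$. The symbol $\simeq$ means that the ratio of the two sides tends to $1$. *)

(* Defs.v *)
From mathcomp Require Import all_boot all_order all_fingroup all_algebra.
From mathcomp Require Import complex finmap.
From mathcomp Require Import all_classical all_reals all_analysis.
Set Implicit Arguments.
Unset Strict Implicit.
Unset Printing Implicit Defensive.
Import Order.TTheory GRing.Theory Num.Theory.
Import numFieldNormedType.Exports.
Local Open Scope classical_set_scope.
Local Open Scope ring_scope.

(* e^(2 pi i / p) *)
Definition Butson_w (R : realType) (p : nat) : R[i] :=
  Complex (cos (2 * pi / p%:R)) (sin (2 * pi / p%:R)).

Definition mx_unity (R : realType) (p M N : nat) : set 'M[R[i]]_(M, N) :=
  [set H : 'M[R[i]]_(M, N) | forall i j, p.-unity_root (H i j)].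

(* [dotmx u v] is the Hermitian scalar product, the sum of the u_k * (v_k)^* . *)
Definition partial_Butson (R : realType) (p M N : nat) : set 'M[R[i]]_(M, N) :=
  [set H : 'M[R[i]]_(M, N) | mx_unity p H /\
    forall i j : 'I_M, i != j -> dotmx (row i H) (row j H) = 0].

Definition dephased (R : realType) (M N : nat) (H : 'M[R[i]]_(M.+1, N)) : Prop :=
  forall k, H ord0 k = 1.

(* Indices start at 0, so the (i, j) entry counts the columns (1, w^i, w^j),
   where w is Butson_w R p. *)
Definition multiplicity_mx (R : realType) (p N : nat) (H : 'M[R[i]]_(3, N)) :
    'M[nat]_p :=
  \matrix_(i < p, j < p)
    #|[set k : 'I_N |
        col k H == \col_(r < 3) [:: 1; Butson_w R p ^+ i; Butson_w R p ^+ j]`_r]%SET|.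

(* The common sum is taken in rat, so that it may be the quotient N / p. *)
Definition tristochastic (p : nat) (s : rat) : set 'M[nat]_p :=
  [set A : 'M[nat]_p |
    [/\ forall i : 'I_p, (\sum_(j < p) A i j)%N%:R = s,
        forall j : 'I_p, (\sum_(i < p) A i j)%N%:R = s &
        forall c : 'I_p,
          (\sum_(i < p) \sum_(j < p | j == i + c %[mod p]) A i j)%N%:R = s]].

(* Probability of E under the uniform law on Omega; meaningful when Omega is
   finite and nonempty, since fset_set is empty on infinite sets. *)
Definition uniform_proba (R : realType) (T : choiceType) (Omega E : set T) : R :=
  #|` fset_set (Omega `&` E)|%:R / #|` fset_set Omega|%:R.

Lemma finite_mx_unity (R : realType) (p M N : nat) : (0 < p)%N ->
  finite_set (@mx_unity R p M N).
Proof.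
move=> p_gt0.
have fin1 : finite_set [set z : R[i] | p.-unity_root z].
  have [rs Xp] := closed_field_poly_normal ('X^p - 1 : {poly R[i]}).
  apply: (sub_finite_set _ (finite_seq rs)) => z /= zp.
  move: zp; rewrite /root_of_unity Xp rootZ ?root_prod_XsubC //.
  by rewrite lead_coef_eq0 -size_poly_eq0 size_XnsubC.
have [s /= sE] : exists s : seq R[i], [set z : R[i] | p.-unity_root z] = [set` s].
  by move/finite_seqP: fin1.
have sP z : p.-unity_root z = (z \in s).
  by apply/idP/idP => h; move/seteqP: sE => [/(_ z) + /(_ z)] => /=; auto.
pose f (E : {ffun 'I_M * 'I_N -> seq_sub s}) : 'M[R[i]]_(M, N) :=
  \matrix_(i, j) val (E (i, j)).
have finf : finite_set (range f) := finite_image f finite_finset.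
apply: sub_finite_set finf => H /= Hp.
have Hs i j : H i j \in s by rewrite -sP.
exists [ffun x : 'I_M * 'I_N => SeqSub (Hs x.1 x.2)] => //.
by apply/matrixP => i j; rewrite mxE ffunE.
Qed.

Definition Butson_proba (R : realType) (p M N : nat) : R :=
  uniform_proba R (@mx_unity R p M N) (@partial_Butson R p M N).

(* Main.v *)
(* The scalar products of the rows of H are sums of p-th roots of unity, and for
   p prime a sum of p-th roots of unity vanishes exactly when each root occurs
   equally often, by irreducibility of the cyclotomic polynomial.

   For p = 3 the tristochastic matrices of sum n are the A_ij = x_(i+j) with
   x_0 + x_1 + x_2 = n, so the probability with N = 3n columns is M_n S_n, where
   M_n = (3n)! / (n!^3 27^n) and S_n is the sum of the cubes of the trinomial
   probabilities n! / (a! b! c! 3^n).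

   M_n is a partial product of Euler's product for sin (pi z) at z = 1/3, so that
   n M_n tends to sqrt 3 / (2 pi).

   For S_n write n = 9e + r with r < 9. Near (e, e, e) the cube of the trinomial
   probability of (2e + a, 2e + b, 2e + c) with n trials is asymptotically kappa
   times that of (a, b, c) with 3e + r trials, kappa being determined by the
   values at the centre, and the latter probabilities sum to 1. The comparison
   has relative error O(eps) within distance e eps^2 of the centre, where
   eps = e^(-1/5); the remaining terms are negligible by Chebyshev's inequality.
   Hence S_n is equivalent to kappa, that is to 3 (sqrt 3 / (2 pi n))^2. *)

Require Import Defs.
From mathcomp Require Import all_boot all_order all_fingroup all_algebra all_field.
From mathcomp Require Import complex finmap.
From mathcomp Require Import all_classical all_reals all_analysis.
From mathcomp Require Import ring lra zify.
Set Implicit Arguments.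
Unset Strict Implicit.
Unset Printing Implicit Defensive.
Import Order.TTheory GRing.Theory Num.Theory.
Import numFieldNormedType.Exports.
Local Open Scope classical_set_scope.
Local Open Scope ring_scope.

(** * Euler's product for the sine *)

Section SineProduct.
Variable R : realType.
Implicit Types (z t : R) (b : R -> R) (k : nat).

Lemma le_of_derive_ge0 (h h' : R -> R) (b : R) : 0 <= b ->
  (forall x : R, is_derive x 1 h (h' x)) ->
  (forall x, 0 <= x <= b -> 0 <= h' x) -> h 0 <= h b.
Proof.
move=> b0 dh h'0.
have cont : {within `[0, b], continuous h}.
  by apply: derivable_within_continuous => x _; apply: ex_derive.
have [c] := MVT_segment b0 (fun x _ => dh x) cont.
rewrite in_itv /= => cb E; rewrite -subr_ge0 E mulr_ge0 ?subr_ge0 //.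
exact: h'0.
Qed.

Lemma sin_le_id t : 0 <= t -> sin t <= t.
Proof.
move=> t0.
have D (x : R) : is_derive x 1 (fun x => x - sin x) (1 - cos x) by apply: is_derive_eq.
have := le_of_derive_ge0 t0 D; rewrite sin0 subr0 subr_ge0; apply => x _.
by rewrite subr_ge0 cos_le1.
Qed.

Lemma cos_ge_quadratic t : 0 <= t -> 1 - t ^+ 2 / 2 <= cos t.
Proof.
move=> t0.
have D (x : R) : is_derive x 1 (fun x => cos x + x ^+ 2 / 2) (x - sin x).
  by apply: is_derive_eq; rewrite /GRing.scale /=; field.
have := le_of_derive_ge0 t0 D; rewrite cos0 expr0n mul0r addr0 lerBlDr; apply => x.
by move=> /andP[x0 _]; rewrite subr_ge0 sin_le_id.
Qed.

Lemma mul_cos_le_sin t : 0 <= t <= pi / 2 -> t * cos t <= sin t.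
Proof.
move=> /andP[t0 tp].
have D (x : R) : is_derive x 1 (fun x => sin x - x * cos x) (x * sin x).
  by apply: is_derive_eq; rewrite /GRing.scale /=; ring.
have := le_of_derive_ge0 t0 D; rewrite sin0 mul0r subr0 subr_ge0; apply => x.
move=> /andP[x0 xt]; rewrite mulr_ge0 // sin_ge0_pi // x0 /=.
have := pi_ge0 R; lra.
Qed.

Fixpoint cos_pow_primitive b z k t : R :=
  if k is k'.+1 then
    let n := (2 * k)%:R in
    (n * (n - 1) * cos_pow_primitive b z k' t
      + n * (cos (2 * z * t) * cos t ^+ (2 * k').+1 * sin t)
      - 2 * z * (sin (2 * z * t) * cos t ^+ (2 * k').+2))
    / (n ^+ 2 - 4 * z ^+ 2)
  else b t.

Lemma is_derive_cosX m t :
  is_derive t 1 (fun x => cos x ^+ m.+1) (- (m.+1%:R * cos t ^+ m * sin t)).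
Proof.
have -> : (fun x : R => cos x ^+ m.+1) = cos ^+ m.+1 by apply/funext => x; rewrite exprfctE.
by apply: is_derive_eq (is_deriveX m.+1 (is_derive_cos t)) _; rewrite /GRing.scale /= mulrN.
Qed.

Lemma is_derive_cos_pow_primitive b z k t :
  `|z| < 1 -> (forall x : R, is_derive x 1 b (cos (2 * z * x))) ->
  is_derive t 1 (cos_pow_primitive b z k) (cos (2 * z * t) * cos t ^+ (2 * k)).
Proof.
move=> z1 db; elim: k => [|k IHk]; first by rewrite muln0 expr0 mulr1.
have nz : (2 * k.+1)%:R ^+ 2 - 4 * z ^+ 2 != 0 :> R.
  rewrite subr_eq0 eq_sym lt_eqF //.
  have : z ^+ 2 < 1 by rewrite -real_normK ?num_real // exprn_ilt1.
  rewrite natrM exprMn => ?.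
  have : 1 <= k.+1%:R ^+ 2 :> R by rewrite exprn_ege1 // ler1n.
  lra.
rewrite /=; set n := (2 * k.+1)%:R in nz *.
have dc : is_derive t 1 (fun t => cos (2 * z * t)) (- (2 * z) * sin (2 * z * t)).
  apply: is_derive_eq; rewrite /GRing.scale /=; ring.
have ds : is_derive t 1 (fun t => sin (2 * z * t)) ((2 * z) * cos (2 * z * t)).
  apply: is_derive_eq; rewrite /GRing.scale /=; ring.
have dp := is_derive_cosX (2 * k) t; have dq := is_derive_cosX (2 * k).+1 t.
set a := n * (n - 1); set D := (_ - _)^-1.
have -> : (fun x => (a * cos_pow_primitive b z k x
      + n * (cos (2 * z * x) * cos x ^+ (2 * k).+1 * sin x)
      - 2 * z * (sin (2 * z * x) * cos x ^+ (2 * k).+2)) * D) =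
   D \*: ((a \*: cos_pow_primitive b z k + n \*: ((fun x => cos (2 * z * x)) * (fun x => cos x ^+
     (2 * k).+1) * sin))
     - (2 * z) \*: ((fun x => sin (2 * z * x)) * (fun x => cos x ^+ (2 * k).+2))).
  by apply/funext => x; rewrite mulrC.
apply: is_derive_eq (is_deriveZ D (is_deriveB (is_deriveD (is_deriveZ a IHk)
  (is_deriveZ n (is_deriveM (is_deriveM dc dp) (is_derive_sin t))))
  (is_deriveZ (2 * z) (is_deriveM ds dq)))) _.
rewrite /GRing.scale /= mulrC; apply: (canLR (mulfK nz)).
have -> : (2 * k.+1 = (2 * k).+2)%N by lia.
have -> : (2 * k).+1%:R = n - 1 by rewrite /n; ring.
have -> : (2 * k).+2%:R = n by rewrite /n; ring.
rewrite /a mulrfctE !exprS !expr0; have := sin2cos2 t; rewrite !expr2 => s2.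
ring: s2.
Qed.

Lemma cos_pow_primitive0 b z k : b 0 = 0 -> cos_pow_primitive b z k 0 = 0.
Proof.
move=> b0; elim: k => [|k IHk] //=.
by rewrite IHk sin0 !mulr0 sin0 !mul0r !mulr0 addr0 subr0 mul0r.
Qed.

Lemma cos_pow_primitive_pihalf b z k :
  cos_pow_primitive b z k.+1 (pi / 2) =
  (2 * k.+1)%:R * ((2 * k.+1)%:R - 1) * cos_pow_primitive b z k (pi / 2)
    / ((2 * k.+1)%:R ^+ 2 - 4 * z ^+ 2).
Proof.
by rewrite /= cos_pihalf !exprS !mul0r !mulr0 !mul0r !mulr0 addr0 subr0.
Qed.

Let I0 k := cos_pow_primitive id 0 k (pi / 2).
Let I z k := cos_pow_primitive (fun t => sin (2 * z * t) / (2 * z)) z k (pi / 2).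

Let I0S k : I0 k.+1 = (2 * k).+1%:R / (2 * k).+2%:R * I0 k.
Proof.
rewrite /I0 cos_pow_primitive_pihalf expr0n mulr0 subr0.
have -> : (2 * k.+1 = (2 * k).+2)%N by lia.
have : (2 * k).+2%:R != 0 :> R by rewrite pnatr_eq0.
by move: (I0 k) => x; rewrite -[(2 * k).+1%:R](addrK 1) -natr1 => ?; field.
Qed.

Let I0_gt0 k : 0 < I0 k.
Proof.
elim: k => [|k IH]; first by rewrite /I0 /= divr_gt0 // pi_gt0.
by rewrite I0S mulr_gt0 // divr_gt0.
Qed.

Let dI0 k (t : R) : is_derive t 1 (cos_pow_primitive id 0 k) (cos t ^+ (2 * k)).
Proof.
have -> : cos t ^+ (2 * k) = cos (2 * 0 * t) * cos t ^+ (2 * k).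
  by rewrite mulr0 mul0r cos0 mul1r.
apply: is_derive_cos_pow_primitive; rewrite ?normr0 // => x.
by rewrite mulr0 mul0r cos0; apply: is_derive_id.
Qed.

Let dI z k (t : R) : z != 0 -> `|z| < 1 ->
  is_derive t 1 (cos_pow_primitive (fun t => sin (2 * z * t) / (2 * z)) z k)
    (cos (2 * z * t) * cos t ^+ (2 * k)).
Proof.
move=> z0 z1; apply: is_derive_cos_pow_primitive => // x.
apply: is_derive_eq; rewrite /GRing.scale /=; field.
exact: z0.
Qed.

Local Arguments cos_pow_primitive : simpl never.

Let cosX_ge0 k t : 0 <= cos t ^+ (2 * k).
Proof. by rewrite exprM exprn_ge0 // sqr_ge0. Qed.

Let I_le z k : z != 0 -> `|z| < 1 -> I z k <= I0 k.
Proof.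
move=> z0 z1; rewrite -subr_ge0.
have D (t : R) := is_deriveB (dI0 k t) (dI k t z0 z1).
have p2 : 0 <= pi / 2 :> R by rewrite divr_ge0 // pi_ge0.
have := le_of_derive_ge0 p2 D.
rewrite !fctE !cos_pow_primitive0 ?mulr0 ?sin0 ?mul0r // subr0; apply => x _.
by rewrite -[X in X - _]mul1r -mulrBl mulr_ge0 ?subr_ge0 ?cos_le1.
Qed.

(* Since t cos t <= sin t, t^2 cos^(2k+2) t <= cos^(2k) t - cos^(2k+2) t. *)
Let I_ge z k : 0 < z -> z < 1 ->
  I0 k.+1 * (1 - 2 * z ^+ 2 / (2 * k).+1%:R) <= I z k.+1.
Proof.
move=> z0 z1; have zn : `|z| < 1 by rewrite gtr0_norm.
have D (t : R) := is_deriveB (dI k.+1 t (lt0r_neq0 z0) zn) (is_deriveB (dI0 k.+1 t)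
  (is_deriveZ (2 * z ^+ 2) (is_deriveB (dI0 k t) (dI0 k.+1 t)))).
have p2 : 0 <= pi / 2 :> R by rewrite divr_ge0 // pi_ge0.
have -> : I0 k.+1 * (1 - 2 * z ^+ 2 / (2 * k).+1%:R) = I0 k.+1 - 2 * z ^+ 2 * (I0 k - I0 k.+1).
  rewrite I0S -[(2 * k).+2%:R]natr1.
  have : (2 * k).+1%:R + 1 != 0 :> R by rewrite natr1 pnatr_eq0.
  have : (2 * k).+1%:R != 0 :> R by rewrite pnatr_eq0.
  by move=> ? ?; field; apply/andP.
rewrite -subr_ge0; have := le_of_derive_ge0 p2 D.
rewrite !fctE /GRing.scale /= !cos_pow_primitive0 ?mulr0 ?sin0 ?mul0r // subr0 scaler0 !subr0;
  apply => x /andP[x0 xp].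
have -> : (2 * k.+1 = 2 * k + 2)%N by lia.
rewrite exprD.
have -> : cos (2 * z * x) * (cos x ^+ (2 * k) * cos x ^+ 2) - (cos x ^+ (2 * k) * cos x ^+ 2 -
    2 * z ^+ 2 * (cos x ^+ (2 * k) - cos x ^+ (2 * k) * cos x ^+ 2)) =
  cos x ^+ (2 * k) * ((cos (2 * z * x) - 1) * cos x ^+ 2 + 2 * z ^+ 2 * (1 - cos x ^+ 2)) by ring.
rewrite mulr_ge0 // -sin2cos2.
have h1 : - (2 * z ^+ 2 * x ^+ 2) <= cos (2 * z * x) - 1.
  have := @cos_ge_quadratic (2 * z * x); rewrite !mulr_ge0 // ?(ltW z0) // => /(_ isT).
  by rewrite !exprMn; lra.
have h2 : x ^+ 2 * cos x ^+ 2 <= sin x ^+ 2.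
  rewrite -exprMn lerXn2r ?nnegrE ?mul_cos_le_sin ?x0 //.
    by rewrite mulr_ge0 // cos_ge0_pihalf // xp andbT; lra.
  by rewrite sin_ge0_pi // x0; have := pi_ge0 R; lra.
have h3 : 0 <= cos x ^+ 2 by exact: sqr_ge0.
have := ler_wpM2r h3 h1; have := ler_wpM2l (sqr_ge0 z) h2; lra.
Qed.

Let prodI z k : 0 < z -> z < 1 ->
  \prod_(j < k) (1 - z ^+ 2 / j.+1%:R ^+ 2) = sin (pi * z) / (pi * z) / (I z k / I0 k).
Proof.
move=> z0 z1.
have pn := lt0r_neq0 (pi_gt0 R); have zn := lt0r_neq0 z0.
have s0 : sin (pi * z) != 0.
  by rewrite gt_eqF // sin_gt0_pi // mulr_gt0 ?pi_gt0 //= gtr_pMr ?pi_gt0.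
have IE : I z k * \prod_(j < k) (1 - z ^+ 2 / j.+1%:R ^+ 2) = sin (pi * z) / (pi * z) * I0 k.
  elim: k => [|k IH].
    have -> : I z 0 = sin (pi * z) / (2 * z).
      by rewrite -[LHS]/(sin (2 * z * (pi / 2)) / (2 * z)); congr (sin _ / _);
        move: (@pi R) => q; field.
    have -> : I0 0 = pi / 2 by [].
    rewrite big_ord0 mulr1; move: (@pi R) pn (sin _) => q qn s.
    by field; rewrite zn.
  rewrite big_ord_recr /= I0S [RHS]mulrCA -IH /I cos_pow_primitive_pihalf -/(I z k).
  have -> : (2 * k.+1 = (2 * k).+2)%N by lia.
  have -> : (2 * k).+2%:R = 2 * k.+1%:R :> R by rewrite -!natr1 natrM; ring.
  have -> : (2 * k).+1%:R = 2 * k.+1%:R - 1 :> R.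
    by rewrite -!natr1 natrM; ring.
  have h1 : k.+1%:R != 0 :> R by rewrite pnatr_eq0.
  have h2 : k.+1%:R ^+ 2 - z ^+ 2 != 0.
    rewrite gt_eqF // subr_gt0 ltrXn2r ?nnegrE ?ltW //.
    by apply: lt_le_trans z1 _; rewrite ler1n.
  move: (I z k) (\prod_(j < k) _) k.+1%:R h1 h2 => u P x h1 h2; field.
  have -> : (2 * x) ^+ 2 - 4 * z ^+ 2 = 4 * (x ^+ 2 - z ^+ 2) by ring.
  by rewrite h1 mulf_neq0 // pnatr_eq0.
have I0n := lt0r_neq0 (I0_gt0 k).
have In : I z k != 0.
  apply/eqP => E; move/eqP: IE; rewrite E mul0r eq_sym !mulf_eq0 invr_eq0 mulf_eq0.
  by rewrite (negPf s0) (negPf pn) (negPf zn) (negPf I0n).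
rewrite -[sin _ / _](mulfK I0n) -IE; field.
by rewrite In I0n.
Qed.

Lemma sine_product z : 0 < z -> z < 1 ->
  (fun k => \prod_(j < k) (1 - z ^+ 2 / j.+1%:R ^+ 2)) @ \oo --> sin (pi * z) / (pi * z).
Proof.
move=> z0 z1; under eq_fun do rewrite prodI //.
set c := sin _ / _.
suff J1 : (fun k => I z k / I0 k) @ \oo --> (1 : R).
  have : (fun k => c * (I z k / I0 k)^-1) @ \oo --> c * 1^-1.
    by apply: cvgM; [exact: cvg_cst|apply: cvgV].
  by rewrite invr1 mulr1.
rewrite -(cvg_shiftS (fun k => I z k / I0 k)) /=.
apply: (@squeeze_cvgr _ _ _ _ (fun k => 1 - 2 * z ^+ 2 * (2 * k).+1%:R^-1) (fun=> 1)).
- near=> k; rewrite ler_pdivlMr ?I0_gt0 // mulrC I_ge //= ler_pdivrMr ?I0_gt0 // mul1r.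
  by rewrite I_le // ?gtr0_norm // lt0r_neq0.
- have : (fun k => 1 - 2 * z ^+ 2 * (2 * k).+1%:R^-1) @ \oo --> 1 - 2 * z ^+ 2 * 0.
    apply: cvgB; first exact: cvg_cst.
    apply: cvgM; first exact: cvg_cst.
    apply: (@squeeze_cvgr _ _ _ _ (fun=> 0) (@harmonic R)); last exact: cvg_harmonic.
      by near=> k; rewrite invr_ge0 ler0n /= lef_pV2 ?posrE // ler_nat; lia.
    exact: cvg_cst.
  by rewrite mulr0 subr0.
- exact: cvg_cst.
Unshelve. all: by end_near.
Qed.

End SineProduct.

Section CentralTrinomial.
Variable R : realType.

Lemma sin_pi3 : sin (pi / 3) = Num.sqrt 3 / 2 :> R.
Proof.
set x : R := pi / 3.
have x0 : 0 < sin x by rewrite sin_gt0_pi // /x; have := pi_gt0 R; lra.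
have : sin (x *+ 2 + x) = 0.
  rewrite -[RHS](sinpi R); congr sin; rewrite /x mulr2n.
  by move: (@pi R) => q; field.
rewrite sinD sin_mulr2n cos_mulr2n mulr2n mulrDl -mulrA [sin x * cos x]mulrC mulrA -expr2
  cos2sin2 => E.
have {E} : sin x * (3 - 4 * sin x ^+ 2) = 0 by rewrite -E; ring.
move/eqP; rewrite mulf_eq0 gt_eqF //= => /eqP E.
have -> : 3 = (2 * sin x) ^+ 2 by rewrite exprMn; lra.
by rewrite sqrtr_sqr ger0_norm ?mulr_ge0 ?ltW // mulrAC divff ?mul1r.
Qed.

(* For r = 0, the probability of (e, e, e) under the uniform trinomial law; in
   general, an upper bound for its probabilities with 3 e + r trials. *)
Definition trinomial_peak (e r : nat) : R :=
  (3 * e + r)`!%:R / (e`!%:R ^+ 3 * e%:R ^+ r * 3 ^+ (3 * e + r)).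

Lemma trinomial_peakE e :
  (3 * e).+1%:R * trinomial_peak e 0 = \prod_(j < e) (1 - 3^-1 ^+ 2 / j.+1%:R ^+ 2).
Proof.
elim: e => [|e IH].
  by rewrite big_ord0 /trinomial_peak muln0 addn0 fact0 !expr0 !expr1n !mulr1 divr1 mulr1.
rewrite big_ord_recr /= -IH /trinomial_peak !addn0 !expr0 !mulr1.
have -> : (3 * e.+1 = (3 * e).+3)%N by lia.
rewrite !factS !natrM [3 ^+ (3 * e).+3](exprSr _ _) [3 ^+ (3 * e).+2](exprSr _ _) [3 ^+ (3 *
  e).+1](exprSr _ _).
rewrite -[(3 * e).+4%:R]natr1 -[(3 * e).+3%:R]natr1 -[(3 * e).+2%:R]natr1 -[(3 * e).+1%:R]natr1
  -[e.+1%:R]natr1.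
have -> : (3 * e)%:R = 3 * e%:R :> R by rewrite natrM.
have h0 : 0 <= e%:R :> R by [].
have h1 : e%:R + 1 != 0 :> R by rewrite gt_eqF //; lra.
have h2 : e`!%:R != 0 :> R by rewrite pnatr_eq0 -lt0n fact_gt0.
have h3 : 3 ^+ (3 * e) != 0 :> R by rewrite expf_neq0 // pnatr_eq0.
move: (3 ^+ (3 * e)) e`!%:R (3 * e)`!%:R e%:R h1 h2 h3 => T u v x h1 h2 h3.
by field; rewrite h1 h2 h3.
Qed.

Lemma trinomial_peak_cvg :
  (fun e => e%:R * trinomial_peak e 0) @ \oo --> Num.sqrt 3 / (2 * pi).
Proof.
have z1 : 3^-1 < 1 :> R by lra.
have := @sine_product R 3^-1 (ltac:(lra)) z1.
under eq_fun do rewrite -trinomial_peakE.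
rewrite sin_pi3 => C.
have H : (fun e : nat => 1 - (3 * e).+1%:R^-1 : R) @ \oo --> (1 - 0 : R).
  apply: cvgB; first exact: cvg_cst.
  apply: (@squeeze_cvgr _ _ _ _ (fun=> 0) (@harmonic R)); last exact: cvg_harmonic.
    by near=> k; rewrite invr_ge0 ler0n /= lef_pV2 ?posrE // ler_nat; lia.
  exact: cvg_cst.
have pn := lt0r_neq0 (pi_gt0 R).
have {C H} : (fun e : nat => 3^-1 * ((3 * e).+1%:R * trinomial_peak e 0 * (1 - (3 * e).+1%:R^-1)))
    @ \oo --> 3^-1 * (Num.sqrt 3 / 2 / (pi / 3) * (1 - 0) : R).
  by apply: cvgM; [exact: cvg_cst|exact: cvgM].
have -> : 3^-1 * (Num.sqrt 3 / 2 / (pi / 3) * (1 - 0)) = Num.sqrt 3 / (2 * pi) :> R.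
  by move: (@pi R) pn => q qn; field.
suff -> : (fun e => e%:R * trinomial_peak e 0) = (fun e : nat => 3^-1 *
    ((3 * e).+1%:R * trinomial_peak e 0 * (1 - (3 * e).+1%:R^-1))) by [].
apply/funext => e /=; move: (trinomial_peak e 0) => u; rewrite -[(3 * e).+1%:R]natr1 natrM.
have h0 : 0 <= e%:R :> R by [].
have h1 : 3 * e%:R + 1 != 0 :> R by rewrite gt_eqF //; lra.
by move: e%:R h1 => x h1; field.
Unshelve. all: by end_near.
Qed.

End CentralTrinomial.

(** * The uniform trinomial distribution *)

Section TrinomialDistribution.
Variable R : realType.
Implicit Types (n a b c e r : nat) (f : nat -> nat -> nat -> R) (x d : R).

Definition trinomial n a b c : R :=
  if (a + b + c == n)%N then n`!%:R / (a`!%:R * b`!%:R * c`!%:R * 3 ^+ n) else 0.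

Definition trinomial_sum n A B C f : R :=
  \sum_(a < A) \sum_(b < B) \sum_(c < C) trinomial n a b c * f a b c.

Let factR_gt0 n : 0 < n`!%:R :> R.
Proof. by rewrite ltr0n fact_gt0. Qed.

Lemma trinomial_ge0 n a b c : 0 <= trinomial n a b c.
Proof.
by rewrite /trinomial; case: ifP => // _; rewrite divr_ge0 // !mulr_ge0 // exprn_ge0.
Qed.

Let pred_trinomial n a b c :=
  (if a is a'.+1 then trinomial n a' b c else 0) +
  (if b is b'.+1 then trinomial n a b' c else 0) +
  (if c is c'.+1 then trinomial n a b c' else 0).

Let trinomialS n a b c : trinomial n.+1 a b c = pred_trinomial n a b c / 3.
Proof.
have T3 : 3 ^+ n != 0 :> R by rewrite expf_neq0 // pnatr_eq0.
have [E|E] := eqVneq (a + b + c)%N n.+1; last first.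
  rewrite /pred_trinomial /trinomial (negPf E).
  have -> : (if a is a'.+1 then if (a' + b + c == n)%N then n`!%:R / (a'`!%:R * b`!%:R * c`!%:R *
    3 ^+ n) else 0 else 0) = 0 :> R.
    by case: a E => // a' E; rewrite ifN // -eqSS -!addSn.
  have -> : (if b is b'.+1 then if (a + b' + c == n)%N then n`!%:R / (a`!%:R * b'`!%:R * c`!%:R *
    3 ^+ n) else 0 else 0) = 0 :> R.
    by case: b E => // b' E; rewrite ifN // -eqSS -addSn -addnS.
  have -> : (if c is c'.+1 then if (a + b + c' == n)%N then n`!%:R / (a`!%:R * b`!%:R * c'`!%:R *
    3 ^+ n) else 0 else 0) = 0 :> R.
    by case: c E => // c' E; rewrite ifN // -eqSS -addnS.
  by rewrite !addr0 mul0r.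
pose u : R := n`!%:R / (a`!%:R * b`!%:R * c`!%:R * 3 ^+ n).
have pa : (if a is a'.+1 then trinomial n a' b c else 0) = a%:R * u.
  case: a E @u => [|a] E u; first by rewrite mul0r.
  rewrite /trinomial ifT; last by rewrite -eqSS -!addSn E.
  rewrite /u factS natrM.
  have h1 := lt0r_neq0 (factR_gt0 a); have h2 := lt0r_neq0 (factR_gt0 b);
    have h3 := lt0r_neq0 (factR_gt0 c).
  have h : a.+1%:R != 0 :> R by rewrite pnatr_eq0.
  by move: a.+1%:R h => y h; field; rewrite h h1 h2 h3 T3.
have pb : (if b is b'.+1 then trinomial n a b' c else 0) = b%:R * u.
  case: b E @u pa => [|b] E u _; first by rewrite mul0r.
  rewrite /trinomial ifT; last by rewrite -eqSS -addSn -addnS E.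
  rewrite /u factS natrM.
  have h1 := lt0r_neq0 (factR_gt0 a); have h2 := lt0r_neq0 (factR_gt0 b);
    have h3 := lt0r_neq0 (factR_gt0 c).
  have h : b.+1%:R != 0 :> R by rewrite pnatr_eq0.
  by move: b.+1%:R h => y h; field; rewrite h h1 h2 h3 T3.
have pc : (if c is c'.+1 then trinomial n a b c' else 0) = c%:R * u.
  case: c E @u pa pb => [|c] E u _ _; first by rewrite mul0r.
  rewrite /trinomial ifT; last by rewrite -eqSS -addnS E.
  rewrite /u factS natrM.
  have h1 := lt0r_neq0 (factR_gt0 a); have h2 := lt0r_neq0 (factR_gt0 b);
    have h3 := lt0r_neq0 (factR_gt0 c).
  have h : c.+1%:R != 0 :> R by rewrite pnatr_eq0.
  by move: c.+1%:R h => y h; field; rewrite h h1 h2 h3 T3.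
rewrite /pred_trinomial pa pb pc -!mulrDl -!natrD E /trinomial E eqxx.
rewrite /u factS natrM exprS.
have h1 := lt0r_neq0 (factR_gt0 a); have h2 := lt0r_neq0 (factR_gt0 b);
  have h3 := lt0r_neq0 (factR_gt0 c).
by field; rewrite h1 h2 h3 T3.
Qed.

Lemma trinomial_sumS n A B C f :
  trinomial_sum n.+1 A.+1 B.+1 C.+1 f =
  (trinomial_sum n A B.+1 C.+1 (fun a b c => f a.+1 b c) +
   trinomial_sum n A.+1 B C.+1 (fun a b c => f a b.+1 c) +
   trinomial_sum n A.+1 B.+1 C (fun a b c => f a b c.+1)) / 3.
Proof.
rewrite /trinomial_sum.
transitivity (\sum_(a < A.+1) \sum_(b < B.+1) \sum_(c < C.+1)
   (((if (a : nat) is a'.+1 then trinomial n a' b c else 0) * f a b c +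
   (if (b : nat) is b'.+1 then trinomial n a b' c else 0) * f a b c +
   (if (c : nat) is c'.+1 then trinomial n a b c' else 0) * f a b c) / 3)).
  apply: eq_bigr => a _; apply: eq_bigr => b _; apply: eq_bigr => c _.
  by rewrite trinomialS /pred_trinomial -!mulrDl mulrAC.
under eq_bigr => a _ do under eq_bigr => b _ do rewrite -mulr_suml.
under eq_bigr => a _ do rewrite -mulr_suml.
rewrite -mulr_suml; congr (_ / 3).
under eq_bigr => a _ do under eq_bigr => b _ do rewrite !big_split /=.
under eq_bigr => a _ do rewrite !big_split /=.
rewrite !big_split /=; congr (_ + _ + _).
- by rewrite big_ord_recl /= big1 ?add0r => [|b _]; last by rewrite big1 // => c _; rewrite mul0r.
- by apply: eq_bigr => a _; rewrite big_ord_recl /= big1 ?add0r => [|c _]; last by rewrite mul0r.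
- by apply: eq_bigr => a _; apply: eq_bigr => b _; rewrite big_ord_recl /= mul0r add0r.
Qed.

Let trinomial_sum0 A B C f : trinomial_sum 0 A.+1 B.+1 C.+1 f = f 0 0 0.
Proof.
rewrite /trinomial_sum !big_ord_recl /= /trinomial /= fact0 !mul1r expr0 invr1 mul1r.
rewrite !big1 ?addr0 // => *; rewrite ?big1 // => *; rewrite ?big1 // => *;
  by rewrite ?add0n ?addnS ?addSn /= mul0r.
Qed.

Lemma trinomial_mass n A B C : (n < A)%N -> (n < B)%N -> (n < C)%N ->
  trinomial_sum n A B C (fun _ _ _ => 1) = 1.
Proof.
elim: n A B C => [|n IH] [|A] [|B] [|C] //.
move=> hA hB hC; rewrite trinomial_sumS !IH //; try lia.
by field.
Qed.

Lemma trinomial_second_moment n A B C x y z : (n < A)%N -> (n < B)%N -> (n < C)%N ->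
  trinomial_sum n A B C (fun a b c => (a%:R - x) ^+ 2 + (b%:R - y) ^+ 2 + (c%:R - z) ^+ 2) =
  (n%:R / 3 - x) ^+ 2 + (n%:R / 3 - y) ^+ 2 + (n%:R / 3 - z) ^+ 2 + 2 * n%:R / 3.
Proof.
have S (i : nat) (w : R) : i.+1%:R - w = i%:R - (w - 1) by rewrite -natr1; ring.
elim: n A B C x y z => [|n IH] [|A] [|B] [|C] // x y z.
  by rewrite trinomial_sum0 mul0r mulr0 mul0r addr0.
move=> hA hB hC; rewrite trinomial_sumS.
rewrite [X in X + _ + _](_ : _ = trinomial_sum n A B.+1 C.+1 (fun a b c =>
  (a%:R - (x - 1)) ^+ 2 + (b%:R - y) ^+ 2 + (c%:R - z) ^+ 2)); last first.
  by rewrite /trinomial_sum; do 3!(apply: eq_bigr => ? _); rewrite S.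
rewrite [X in _ + X + _](_ : _ = trinomial_sum n A.+1 B C.+1 (fun a b c =>
  (a%:R - x) ^+ 2 + (b%:R - (y - 1)) ^+ 2 + (c%:R - z) ^+ 2)); last first.
  by rewrite /trinomial_sum; do 3!(apply: eq_bigr => ? _); rewrite S.
rewrite [X in _ + _ + X](_ : _ = trinomial_sum n A.+1 B.+1 C (fun a b c =>
  (a%:R - x) ^+ 2 + (b%:R - y) ^+ 2 + (c%:R - (z - 1)) ^+ 2)); last first.
  by rewrite /trinomial_sum; do 3!(apply: eq_bigr => ? _); rewrite S.
rewrite !IH; try lia.
by rewrite -natr1; field.
Qed.

Definition near_diag d x a b c :=
  [&& `|a%:R - x| <= d, `|b%:R - x| <= d & `|c%:R - x| <= d].

Lemma trinomial_far n A B C d x : 0 < d -> (n < A)%N -> (n < B)%N -> (n < C)%N ->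
  trinomial_sum n A B C (fun a b c => (~~ near_diag d x a b c)%:R) <=
  (3 * (n%:R / 3 - x) ^+ 2 + 2 * n%:R / 3) / d ^+ 2.
Proof.
move=> d0 hA hB hC.
have d2 : 0 < d ^+ 2 by rewrite exprn_gt0.
have -> : 3 * (n%:R / 3 - x) ^+ 2 + 2 * n%:R / 3 =
  (n%:R / 3 - x) ^+ 2 + (n%:R / 3 - x) ^+ 2 + (n%:R / 3 - x) ^+ 2 + 2 * n%:R / 3 by ring.
rewrite -(trinomial_second_moment x x x hA hB hC) ler_pdivlMr //.
rewrite [X in X * _]/trinomial_sum mulr_suml; under eq_bigr do rewrite mulr_suml.
under eq_bigr do under eq_bigr do rewrite mulr_suml.
apply: ler_sum => a _; apply: ler_sum => b _; apply: ler_sum => c _;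
  rewrite -mulrA ler_wpM2l ?trinomial_ge0 //.
have far (t : R) : ~~ (`|t| <= d) -> d ^+ 2 <= t ^+ 2.
  rewrite -ltNge => h; rewrite -[t ^+ 2]real_normK ?num_real // lerXn2r ?nnegrE ?normr_ge0 ?ltW
    //.
rewrite /near_diag !negb_and.
have [h|_] := boolP (~~ _ || _); last by rewrite mul0r !addr_ge0 ?sqr_ge0.
rewrite mul1r; move: (sqr_ge0 (a%:R - x)) (sqr_ge0 (b%:R - x)) (sqr_ge0 (c%:R - x)).
by case/or3P: h => /far; lra.
Qed.

Lemma trinomial_le_peak e r a b c : (0 < e)%N ->
  trinomial (3 * e + r) a b c <= trinomial_peak R e r.
Proof.
move=> e0; rewrite /trinomial; case: eqP => [E|_]; last first.
  by rewrite /trinomial_peak divr_ge0 // !mulr_ge0 // exprn_ge0.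
have up i : (e`! * e ^ i <= (i + e)`!)%N.
  elim: i => [|i IH]; first by rewrite muln1.
  by rewrite addSn factS expnS mulnCA leq_mul //; lia.
have down k i : (i + k <= e -> (i + k)`! <= k`! * e ^ i)%N.
  elim: i => [|i IH] h; first by rewrite muln1.
  by rewrite addSn factS expnS mulnCA leq_mul // IH //; lia.
have fact_ge k : (e`! * e ^ k <= k`! * e ^ e)%N.
  have [/subnK E1|/ltnW/subnK E1] := leqP e k.
    by rewrite -E1 expnD mulnA leq_mul // up.
  have := down k (e - k)%N; rewrite E1 leqnn => /(_ isT).
  by rewrite -(leq_pmul2r (_ : 0 < e ^ k)%N) ?expn_gt0 ?e0 // -mulnA -expnD E1.
have pe : (0 < e ^ e)%N by rewrite expn_gt0 e0.
rewrite /trinomial_peak ler_wpM2l // lef_pV2 ?posrE ?mulr_gt0 ?exprn_gt0 ?ltr0n ?fact_gt0 //.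
rewrite ler_wpM2r ?exprn_ge0 // !exprS expr0 mulr1 mulrA -!natrX -!natrM ler_nat.
rewrite -(leq_pmul2r pe) -(leq_pmul2r pe) -(leq_pmul2r pe).
have := leq_mul (leq_mul (fact_ge a) (fact_ge b)) (fact_ge c).
have H : (e ^ a * e ^ b * e ^ c = e ^ r * e ^ e * e ^ e * e ^ e)%N.
  by rewrite -!expnD E; congr (_ ^ _)%N; lia.
have -> : (e`! * e`! * e`! * e ^ r * e ^ e * e ^ e * e ^ e =
  e`! * e ^ a * (e`! * e ^ b) * (e`! * e ^ c))%N.
  have -> : (e`! * e ^ a * (e`! * e ^ b) * (e`! * e ^ c) =
    e`! * e`! * e`! * (e ^ a * e ^ b * e ^ c))%N by ring.
  by rewrite H; ring.
by move=> h; apply: leq_trans h (eq_leq _); ring.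
Qed.

End TrinomialDistribution.

(** * The sum of the cubes of the trinomial probabilities *)

Section CubeSum.
Variable R : realType.
Implicit Types (n a b c e r x k : nat) (d eps : R).

Let factR_gt0 n : 0 < n`!%:R :> R.
Proof. by rewrite ltr0n fact_gt0. Qed.

(* Up to a constant, a product of three weights is the ratio of the cube of the
   trinomial probability with 9 e + r trials to the shifted one with 3 e + r. *)
Let weight e x : R := x`!%:R * (27 * e%:R ^+ 2) ^+ x / (x + 2 * e)`!%:R ^+ 3.

Let weight_gt0 e x : (0 < e)%N -> 0 < weight e x.
Proof.
move=> e0; rewrite /weight divr_gt0 ?mulr_gt0 ?exprn_gt0 ?factR_gt0 //.
by rewrite mulr_gt0 // exprn_gt0 // ltr0n.
Qed.

Let weightS e x d : (0 < e)%N -> d <= e%:R ->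
  e%:R - d <= x.+1%:R -> x.+1%:R <= e%:R + d ->
  (1 - 2 * (d / e%:R) ^+ 2) * weight e x <= weight e x.+1 <= weight e x.
Proof.
rewrite -[x.+1%:R]natr1 => e0 de h1 h2.
have e0' : 0 < e%:R :> R by rewrite ltr0n.
have x0 : 0 <= x%:R :> R by [].
have X0 : 0 < x%:R + 1 + 2 * e%:R :> R by lra.
have -> : weight e x.+1 = weight e x * (27 * e%:R ^+ 2 * (x%:R + 1) / (x%:R + 1 + 2 * e%:R) ^+ 3).
  rewrite /weight addSn !factS !natrM exprSr -[(x + 2 * e).+1%:R]natr1 natrD natrM-[x.+1%:R]natr1.
  have := lt0r_neq0 (factR_gt0 (x + 2 * e)) => f0.
  have : x%:R + 2 * e%:R + 1 != 0 :> R by rewrite gt_eqF //; lra.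
  have := lt0r_neq0 X0; move: x%:R e%:R => X E n1 n2; by field; rewrite ?n1 ?f0 ?n2.
rewrite mulrC; have w0 := ltW (weight_gt0 x e0).
rewrite -[X in _ <= _ <= X]mulr1 !ler_wpM2l //=.
  rewrite ler_pdivrMr ?exprn_gt0 // mul1r -subr_ge0.
  have -> : (x%:R + 1 + 2 * e%:R) ^+ 3 - 27 * e%:R ^+ 2 * (x%:R + 1) =
    (x%:R + 1 - e%:R) ^+ 2 * (x%:R + 1 + 8 * e%:R) :> R by ring.
  by rewrite mulr_ge0 ?sqr_ge0 //; lra.
rewrite ler_pdivlMr ?exprn_gt0 // -subr_ge0.
have -> : 27 * e%:R ^+ 2 * (x%:R + 1) - (1 - 2 * (d / e%:R) ^+ 2) * (x%:R + 1 + 2 * e%:R) ^+ 3 =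
  2 * (d / e%:R) ^+ 2 * (x%:R + 1 + 2 * e%:R) ^+ 3 - (x%:R + 1 - e%:R) ^+ 2 * (x%:R + 1 + 8 *
    e%:R) :> R by ring.
rewrite subr_ge0.
have i2 : (x%:R + 1 - e%:R) ^+ 2 <= d ^+ 2.
  by rewrite -[leLHS]real_normK ?num_real // lerXn2r ?nnegrE // ?ler_norml; lra.
have X2 : (2 * e%:R) ^+ 3 <= (x%:R + 1 + 2 * e%:R) ^+ 3 :> R.
  by rewrite lerXn2r ?nnegrE //; lra.
apply: (@le_trans _ _ (d ^+ 2 * (10 * e%:R))).
  by apply: ler_pM; rewrite ?sqr_ge0 //; lra.
apply: le_trans (ler_wpM2l _ X2); last by rewrite mulr_ge0 // sqr_ge0.
have -> : 2 * (d / e%:R) ^+ 2 * (2 * e%:R) ^+ 3 = d ^+ 2 * (16 * e%:R).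
  by move: e%:R (lt0r_neq0 e0') => E En; field.
by rewrite ler_wpM2l ?sqr_ge0 //; lra.
Qed.

Let bernoulli (y : R) k : 0 <= y -> y <= 1 -> 1 - k%:R * y <= (1 - y) ^+ k.
Proof.
move=> y0 y1; elim: k => [|k IH]; first by rewrite mul0r subr0.
rewrite exprS; apply: le_trans (ler_wpM2l _ IH); last by lra.
rewrite -natr1; have k0 : 0 <= k%:R :> R by []; have := mulr_ge0 k0 (mulr_ge0 y0 y0); lra.
Qed.

Let weight_chain e x k d : (0 < e)%N -> 0 <= d -> 2 * d <= e%:R ->
  e%:R - d <= x.+1%:R -> (x + k)%:R <= e%:R + d ->
  (1 - 2 * (d / e%:R) ^+ 2) ^+ k * weight e x <= weight e (x + k) <= weight e x.
Proof.
move=> e0 d0 de h1 hk.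
have d1 : 0 <= 1 - 2 * (d / e%:R) ^+ 2.
  rewrite subr_ge0; have : d / e%:R <= 1 / 2 by rewrite ler_pdivrMr ?ltr0n //; lra.
  have : 0 <= d / e%:R by rewrite divr_ge0.
  move: (d / e%:R) => y y0 y1; have := ler_pM y0 y0 y1 y1; rewrite expr2; lra.
elim: k hk => [|k IH] hk; first by rewrite addn0 expr0 mul1r lexx.
rewrite addnS in hk *.
have e0' : 0 < e%:R :> R by rewrite ltr0n.
have : (x + k)%:R <= (x + k).+1%:R :> R by rewrite ler_nat.
have : x.+1%:R <= (x + k).+1%:R :> R by rewrite ler_nat ltnS leq_addr.
move=> u1 u2; have /andP[l1 l2] := IH (le_trans u2 hk).
have /andP[l3 l4] := @weightS e (x + k) d e0 (ltac:(lra)) (le_trans h1 u1) hk.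
rewrite (le_trans l4 l2) andbT exprS -mulrA; apply: le_trans l3.
exact: ler_wpM2l.
Qed.

Let near_weight e x eps : (0 < e)%N -> 0 < eps -> 2 * eps <= 1 -> e%:R * eps ^+ 5 = 1 ->
  `|x%:R - e%:R| <= e%:R * eps ^+ 2 ->
  (1 - 2 * eps) * weight e e <= weight e x /\ (1 - 2 * eps) * weight e x <= weight e e.
Proof.
move=> e0 p0 p1 pe hx; have e0' : 0 < e%:R :> R by rewrite ltr0n.
set d := e%:R * eps ^+ 2 in hx *.
have d0 : 0 <= d by rewrite mulr_ge0 // sqr_ge0.
have p1' : eps <= 1 / 2 by lra.
have p2 : eps ^+ 2 <= 1 / 2.
  by have := ler_pM (ltW p0) (ltW p0) p1' p1'; rewrite expr2; lra.
have de : 2 * d <= e%:R by have := ler_wpM2l (ltW e0') p2; rewrite -/d; lra.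
have dE : 2 * (d / e%:R) ^+ 2 = 2 * eps ^+ 4.
  by rewrite /d; move: e%:R (lt0r_neq0 e0') => E En; field.
have p4 : 2 * eps ^+ 4 <= 1.
  by have := ler_pM (sqr_ge0 eps) (sqr_ge0 eps) p2 p2; rewrite -exprD; lra.
have p40 : 0 <= 2 * eps ^+ 4 by rewrite mulr_ge0 // exprn_ge0 // ltW.
have small k : k%:R <= d -> 1 - 2 * eps <= (1 - 2 * eps ^+ 4) ^+ k.
  move=> kd; apply: le_trans (bernoulli k p40 p4).
  have -> : 2 * eps = d * (2 * eps ^+ 4).
    have -> : d * (2 * eps ^+ 4) = 2 * eps * (e%:R * eps ^+ 5) by rewrite /d; ring.
    by rewrite pe mulr1.
  by rewrite lerD2l lerN2 ler_wpM2r.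
have p12 : 1 - 2 * eps <= 1 by lra.
have we := ltW (weight_gt0 e e0); have wx := ltW (weight_gt0 x e0).
move: hx; rewrite ler_norml => /andP[h1 h2].
have [xe|/ltnW xe] := leqP e x.
  have E : x = (e + (x - e))%N by rewrite subnKC.
  have xk : (x - e)%:R <= d by rewrite natrB //; lra.
  have a1 : e%:R - d <= e.+1%:R by rewrite -natr1; lra.
  have a2 : (e + (x - e))%:R <= e%:R + d by rewrite -E; lra.
  have /andP[] := weight_chain e0 d0 de a1 a2.
  rewrite -E dE => l1 l2; split.
    by apply: le_trans l1; rewrite ler_wpM2r // small.
  by apply: le_trans l2; rewrite ler_piMl.
have E : e = (x + (e - x))%N by rewrite subnKC.
have xk : (e - x)%:R <= d by rewrite natrB //; lra.
have a1 : e%:R - d <= x.+1%:R by rewrite -natr1; lra.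
have a2 : (x + (e - x))%:R <= e%:R + d by rewrite -E; lra.
have /andP[] := weight_chain e0 d0 de a1 a2.
rewrite -E dE => l1 l2; split.
  by apply: le_trans l2; rewrite ler_piMl.
by apply: le_trans l1; rewrite ler_wpM2r // small.
Qed.


Let trinomial_cube e r a b c : (0 < e)%N ->
  trinomial R (9 * e + r) (2 * e + a) (2 * e + b) (2 * e + c) ^+ 3 * weight e e ^+ 3 =
  trinomial_peak R (3 * e) r ^+ 3 / trinomial_peak R e r * trinomial R (3 * e + r) a b c
    * (weight e a * weight e b * weight e c).
Proof.
move=> e0; rewrite /trinomial.
have -> : ((2 * e + a + (2 * e + b) + (2 * e + c) == 9 * e + r) = (a + b + c == 3 * e + r))%N by
  lia.
case: eqP => [E|_]; last by rewrite expr0n mul0r mulr0 mul0r.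
rewrite /trinomial_peak /weight.
have -> : (3 * (3 * e) + r = 9 * e + r)%N by lia.
have -> : (e + 2 * e = 3 * e)%N by lia.
have H : ((27 * e%:R ^+ 2) ^+ a * (27 * e%:R ^+ 2) ^+ b * (27 * e%:R ^+ 2) ^+ c = ((27 * e%:R ^+
  2) ^+ e) ^+ 3 * (27 * e%:R ^+ 2) ^+ r :> R).
  by rewrite -exprM -!exprD; congr (_ ^+ _); lia.
rewrite ![(_ + 2 * e)%N]addnC.
have H2 : (27 * e%:R ^+ 2) ^+ r * e%:R ^+ r = ((3 * e)%:R ^+ r) ^+ 3 :> R.
  by rewrite -exprMn -exprM [(r * 3)%N]mulnC exprM natrM; congr (_ ^+ _); ring.
have e1 : e%:R != 0 :> R by rewrite pnatr_eq0 -lt0n.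
have hB : 27 * e%:R ^+ 2 != 0 :> R by rewrite mulf_neq0 ?expf_neq0 // pnatr_eq0.
have f1 i := lt0r_neq0 (factR_gt0 i).
have -> : e%:R ^+ r = ((3 * e)%:R ^+ r) ^+ 3 / (27 * e%:R ^+ 2) ^+ r :> R.
  by rewrite -H2 mulrAC divff ?mul1r // expf_neq0.
have -> : (27 * e%:R ^+ 2) ^+ c = ((27 * e%:R ^+ 2) ^+ e) ^+ 3 * (27 * e%:R ^+ 2) ^+ r
    / ((27 * e%:R ^+ 2) ^+ a * (27 * e%:R ^+ 2) ^+ b) :> R.
  by rewrite -H mulrAC divff ?mul1r // mulf_neq0 // expf_neq0.
have t1 i : 3 ^+ i != 0 :> R by rewrite expf_neq0 // pnatr_eq0.
have t2 i := expf_neq0 i hB.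
have t3 : (3 * e)%:R ^+ r != 0 :> R by rewrite expf_neq0 // pnatr_eq0 muln_eq0 -lt0n; lia.
move: (f1 e) (f1 a) (f1 b) (f1 c) (f1 (2 * e + a)%N) (f1 (2 * e + b)%N) (f1 (2 * e + c)%N)
  (f1 (3 * e)%N) (f1 (3 * e + r)%N) (t1 (9 * e + r)%N) (t1 (3 * e + r)%N) (t2 e) (t2 a) (t2 b)
    (t2 r) t3.
move: (e`!%:R) (a`!%:R) (b`!%:R) (c`!%:R) ((2 * e + a)`!%:R) ((2 * e + b)`!%:R) ((2 * e + c)`!%:R)
  ((3 * e)`!%:R) ((3 * e + r)`!%:R) (3 ^+ (9 * e + r)) (3 ^+ (3 * e + r)) ((27 * e%:R ^+ 2) ^+ e)
  ((27 * e%:R ^+ 2) ^+ a) ((27 * e%:R ^+ 2) ^+ b) ((27 * e%:R ^+ 2) ^+ r) ((3 * e)%:R ^+ r).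
move=> x1 x2 x3 x4 x5 x6 x7 x8 x9 x10 x11 x12 x13 x14 x15 x16.
move=> y1 y2 y3 y4 y5 y6 y7 y8 y9 y10 y11 y12 y13 y14 y15 y16.
by field; rewrite ?y1 ?y2 ?y3 ?y4 ?y5 ?y6 ?y7 ?y8 ?y9 ?y10 ?y11 ?y12 ?y13 ?y14 ?y15 ?y16.
Qed.

Definition sum3 K (f : nat -> nat -> nat -> R) : R :=
  \sum_(a < K) \sum_(b < K) \sum_(c < K) f a b c.

Lemma ler_sum3 K f g : (forall a b c, f a b c <= g a b c) -> sum3 K f <= sum3 K g.
Proof. by move=> fg; do 3!(apply: ler_sum => ? _). Qed.

Lemma mulr_sum3r K f (z : R) : z * sum3 K f = sum3 K (fun a b c => z * f a b c).
Proof.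
rewrite /sum3 mulr_sumr; apply: eq_bigr => a _; rewrite mulr_sumr; apply: eq_bigr => b _.
by rewrite mulr_sumr.
Qed.

Lemma sum3D K f g : sum3 K f + sum3 K g = sum3 K (fun a b c => f a b c + g a b c).
Proof.
rewrite /sum3 -big_split; apply: eq_bigr => a _; rewrite -big_split; apply: eq_bigr => b _.
by rewrite -big_split.
Qed.

Lemma eq_sum3 K f g : (forall a b c, f a b c = g a b c) -> sum3 K f = sum3 K g.
Proof. by move=> fg; do 3!(apply: eq_bigr => ? _). Qed.

Lemma sum3_shift s k (f : nat -> nat -> nat -> R) :
  (forall a b c, (a < s)%N || (b < s)%N || (c < s)%N -> f a b c = 0) ->
  sum3 (s + k) f = sum3 k (fun a b c => f (s + a)%N (s + b)%N (s + c)%N).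
Proof.
move=> f0; rewrite /sum3 big_split_ord /= big1 ?add0r => [|a _]; last first.
  by do 2!(rewrite big1 // => ? _); rewrite f0 // ltn_ord.
apply: eq_bigr => a _; rewrite big_split_ord /= big1 ?add0r => [|b _]; last first.
  by rewrite big1 // => ? _; rewrite f0 // ltn_ord orbT.
apply: eq_bigr => b _; rewrite big_split_ord /= big1 ?add0r => [|c _]; last first.
  by rewrite f0 // ltn_ord !orbT.
by [].
Qed.

Definition trinomial_cube_sum n : R := sum3 n.+1 (fun a b c => trinomial R n a b c ^+ 3).

Let kappa e r : R := trinomial_peak R (3 * e) r ^+ 3 / trinomial_peak R e r.

Let peak_gt0 e r : (0 < e)%N -> 0 < trinomial_peak R e r.
Proof.
move=> e0; rewrite /trinomial_peak divr_gt0 ?factR_gt0 // !mulr_gt0 ?exprn_gt0 ?factR_gt0 //.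
by rewrite ltr0n.
Qed.

Let kappa_gt0 e r : (0 < e)%N -> 0 < kappa e r.
Proof. by move=> e0; rewrite /kappa divr_gt0 ?exprn_gt0 ?peak_gt0 //; lia. Qed.

Let near_cube e r a b c eps : (0 < e)%N -> 0 < eps -> 2 * eps <= 1 -> e%:R * eps ^+ 5 = 1 ->
  near_diag (e%:R * eps ^+ 2) e%:R a b c ->
  let t := trinomial R (9 * e + r) (2 * e + a) (2 * e + b) (2 * e + c) ^+ 3 in
  let m := kappa e r * trinomial R (3 * e + r) a b c in
  (1 - 2 * eps) ^+ 3 * m <= t /\ (1 - 2 * eps) ^+ 3 * t <= m.
Proof.
move=> e0 p0 p1 pe /and3P[ha hb hc] t m.
have w0 := exprn_gt0 3 (weight_gt0 e e0).
have m0 : 0 <= m by rewrite mulr_ge0 ?trinomial_ge0 // ltW ?kappa_gt0.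
have := trinomial_cube r a b c e0; rewrite -/(kappa e r) -/t -/m => E.
have [la ua] := near_weight e0 p0 p1 pe ha.
have [lb ub] := near_weight e0 p0 p1 pe hb.
have [lc uc] := near_weight e0 p0 p1 pe hc.
have q0 : 0 <= 1 - 2 * eps by lra.
have we := ltW (weight_gt0 e e0).
have wa := ltW (weight_gt0 a e0).
have wb := ltW (weight_gt0 b e0).
have wc := ltW (weight_gt0 c e0).
split; rewrite -(ler_pM2r w0).
  rewrite E; have -> : (1 - 2 * eps) ^+ 3 * m * weight e e ^+ 3 =
    m * ((1 - 2 * eps) * weight e e * ((1 - 2 * eps) * weight e e) * ((1 - 2 * eps) * weight e
      e)) by ring.
  rewrite ler_wpM2l //.
  by apply: ler_pM; rewrite ?mulr_ge0 //; apply: ler_pM; rewrite ?mulr_ge0.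
rewrite -mulrA E mulrCA ler_wpM2l //.
have -> : (1 - 2 * eps) ^+ 3 * (weight e a * weight e b * weight e c) =
  (1 - 2 * eps) * weight e a * ((1 - 2 * eps) * weight e b) * ((1 - 2 * eps) * weight e c) by
    ring.
rewrite 2!exprSr expr1.
by apply: ler_pM; rewrite ?mulr_ge0 //; apply: ler_pM; rewrite ?mulr_ge0.
Qed.

Let far_bound (n : nat) e r eps K (y : R) : (0 < e)%N -> 0 < eps -> e%:R * eps ^+ 5 = 1 ->
  (n < K)%N -> 3 * (n%:R / 3 - y) ^+ 2 + 2 * n%:R / 3 <= 39 * e%:R ->
  sum3 K (fun a b c => trinomial R n a b c * (~~ near_diag (e%:R * eps ^+ 2) y a b c)%:R) <= 39 *
    eps.
Proof.
move=> e0 p0 pe nK h; have e0' : 0 < e%:R :> R by rewrite ltr0n.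
have d0 : 0 < e%:R * eps ^+ 2 by rewrite mulr_gt0 // exprn_gt0.
apply: le_trans (trinomial_far y d0 nK nK nK) _.
rewrite ler_pdivrMr ?exprn_gt0 //; apply: le_trans h _.
have -> : 39 * eps * (e%:R * eps ^+ 2) ^+ 2 = 39 * e%:R * (e%:R * eps ^+ 5) by ring.
by rewrite pe mulr1.
Qed.

Lemma trinomial_cube_sum_bounds e r eps : (0 < e)%N -> (r < 9)%N ->
    0 < eps -> 2 * eps <= 1 -> e%:R * eps ^+ 5 = 1 ->
  (1 - 2 * eps) ^+ 3 * (kappa e r * (1 - 39 * eps)) <= trinomial_cube_sum (9 * e + r) /\
  (1 - 2 * eps) ^+ 3 * trinomial_cube_sum (9 * e + r) <=
     kappa e r + trinomial_peak R (3 * e) r ^+ 2 * (39 * eps).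
Proof.
move=> e0 r9 p0 p1 pe.
have e0' : 0 < e%:R :> R by rewrite ltr0n.
have e1 : 1 <= e%:R :> R by rewrite ler1n.
have r0 : 0 <= r%:R :> R by [].
have r8 : r%:R <= 8 :> R by rewrite (ler_nat R r 8).
have rr : r%:R * r%:R <= 8 * 8 :> R by apply: ler_pM.
set Q := (1 - 2 * eps) ^+ 3.
have Q0 : 0 <= Q by rewrite exprn_ge0 //; lra.
have Q1 : Q <= 1 by rewrite exprn_ile1 //; lra.
pose n := (9 * e + r)%N; pose m := (3 * e + r)%N; pose K := (7 * e + r).+1.
have nK : n.+1 = (2 * e + K)%N by rewrite /n /K; clear; lia.
have nE : n%:R = 9 * e%:R + r%:R :> R by rewrite natrD natrM.
have mE : m%:R = 3 * e%:R + r%:R :> R by rewrite natrD natrM.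
pose nr a b c := (near_diag (e%:R * eps ^+ 2) (3 * e%:R) a b c)%:R : R.
pose fr a b c := (~~ near_diag (e%:R * eps ^+ 2) (3 * e%:R) a b c)%:R : R.
pose nr' a b c := (near_diag (e%:R * eps ^+ 2) e%:R a b c)%:R : R.
pose fr' a b c := (~~ near_diag (e%:R * eps ^+ 2) e%:R a b c)%:R : R.
have farn : sum3 n.+1 (fun a b c => trinomial R n a b c * fr a b c) <= 39 * eps.
  by apply: far_bound => //; rewrite nE expr2; lra.
have farm : sum3 K (fun a b c => trinomial R m a b c * fr' a b c) <= 39 * eps.
  by apply: far_bound => //; [rewrite /K /m; clear; lia|rewrite mE expr2; lra].
have massm : sum3 K (fun a b c => trinomial R m a b c) = 1.
  have mK : (m < K)%N by rewrite /K /m; clear; lia.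
  rewrite -(trinomial_mass R mK mK mK).
  rewrite -[RHS]/(sum3 K (fun a b c => trinomial R m a b c * 1)).
  by apply: eq_sum3 => *; rewrite mulr1.
have split_m : sum3 K (fun a b c => trinomial R m a b c * nr' a b c) =
    1 - sum3 K (fun a b c => trinomial R m a b c * fr' a b c).
  apply/eqP; rewrite eq_sym subr_eq -massm sum3D; apply/eqP; apply: eq_sum3 => a b c.
  by rewrite -mulrDr /nr' /fr'; case: near_diag; rewrite /= ?addr0 ?add0r mulr1.
have split_n : trinomial_cube_sum n = sum3 n.+1 (fun a b c => trinomial R n a b c ^+ 3 * nr a b c)
    + sum3 n.+1 (fun a b c => trinomial R n a b c ^+ 3 * fr a b c).
  rewrite sum3D; apply: eq_sum3 => a b c.
  by rewrite -mulrDr /nr /fr; case: near_diag; rewrite /= ?addr0 ?add0r mulr1.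
have t0 i a b c : 0 <= trinomial R i a b c by exact: trinomial_ge0.
have near_n : sum3 n.+1 (fun a b c => trinomial R n a b c ^+ 3 * nr a b c) =
    sum3 K (fun a b c => trinomial R n (2 * e + a) (2 * e + b) (2 * e + c) ^+ 3 * nr' a b c).
  have shift a : (2 * e + a)%:R - 3 * e%:R = a%:R - e%:R :> R by rewrite natrD natrM; ring.
  rewrite nK sum3_shift => [|a b c out].
    by apply: eq_sum3 => a b c; rewrite /nr /nr' /near_diag !shift.
  have small i : (i < 2 * e)%N -> ~~ (`|i%:R - 3 * e%:R| <= e%:R * eps ^+ 2).
    rewrite -(ltr_nat R) natrM => h; rewrite -ltNge ltr0_norm ?subr_lt0; last by lra.
    have : eps ^+ 2 <= 1 by rewrite exprn_ile1 //; lra.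
    by move=> /(ler_wpM2l (ltW e0')); lra.
  rewrite /nr /near_diag; case/orP: out => [/orP[]|] /small /negPf ->;
    by rewrite ?andbF /= mulr0.
have H a b c := @near_cube e r a b c eps e0 p0 p1 pe.
split.
  rewrite split_n near_n -[X in X <= _]addr0; apply: lerD; last first.
    by rewrite /sum3; do 3!(apply: sumr_ge0 => ? _); rewrite mulr_ge0 // exprn_ge0.
  apply: (@le_trans _ _ (Q * (kappa e r * sum3 K (fun a b c => trinomial R m a b c * nr' a b
    c)))).
    rewrite split_m; apply: ler_wpM2l => //; apply: ler_wpM2l.
      exact: ltW (kappa_gt0 _ e0).
    by rewrite lerD2l lerN2.
  rewrite !mulr_sum3r; apply: ler_sum3 => a b c; rewrite [kappa e r * _]mulrA [Q * _]mulrA /nr'.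
  case: (boolP (near_diag _ _ _ _ _)) => [/H[+ _]|_]; last by rewrite !mulr0.
  by rewrite !mulr1.
rewrite split_n mulrDr; apply: lerD.
  rewrite near_n -[leRHS]mulr1 -massm !mulr_sum3r; apply: ler_sum3 => a b c;
    rewrite [Q * _]mulrA /nr'.
  case: (boolP (near_diag _ _ _ _ _)) => [/H[_ +]|_]; first by rewrite mulr1.
  by rewrite mulr0 mulr_ge0 // ltW ?kappa_gt0.
apply: (@le_trans _ _ (sum3 n.+1 (fun a b c => trinomial R n a b c ^+ 3 * fr a b c))).
  rewrite ler_piMl // /sum3; do 3!(apply: sumr_ge0 => ? _); by rewrite mulr_ge0 // exprn_ge0.
apply: (@le_trans _ _ (trinomial_peak R (3 * e) r ^+ 2 * sum3 n.+1 (fun a b c => trinomial R n a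
  b c * fr a b c))).
  rewrite mulr_sum3r; apply: ler_sum3 => a b c;
    rewrite exprSr mulrA -[_ * _ * fr _ _ _]mulrA -mulrA.
  rewrite ler_wpM2r ?mulr_ge0 // lerXn2r ?nnegrE ?(ltW (peak_gt0 _ _)) //; first by clear -e0;
    lia.
  have -> : n = (3 * (3 * e) + r)%N by rewrite /n; clear; lia.
  by apply: trinomial_le_peak; clear -e0; lia.
by rewrite ler_wpM2l // sqr_ge0.
Qed.

End CubeSum.

Section CubeSumLimit.
Variable R : realType.

Lemma cvg_expr (u : nat -> R) (l : R) k :
  u @ \oo --> l -> (fun n => u n ^+ k) @ \oo --> l ^+ k.
Proof.
move=> ul; elim: k => [|k IH].
  by under eq_fun do rewrite expr0; rewrite expr0; exact: cvg_cst.
by under eq_fun do rewrite exprS; rewrite exprS; apply: cvgM.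
Qed.

Lemma cvg_invn : (fun n : nat => n%:R^-1 : R) @ \oo --> (0 : R).
Proof. by rewrite -(cvg_shiftS (fun n : nat => n%:R^-1 : R)); exact: cvg_harmonic. Qed.

Lemma trinomial_peak_bounds e r : (0 < e)%N -> (r <= 9)%N ->
  trinomial_peak R e 0 <= trinomial_peak R e r <= trinomial_peak R e 0 * (1 + 3 / e%:R) ^+ 9.
Proof.
move=> e0 r9; have e0' : 0 < e%:R :> R by rewrite ltr0n.
have p0 i : 0 <= trinomial_peak R e i.
  by rewrite /trinomial_peak divr_ge0 // !mulr_ge0 ?exprn_ge0.
have q1 : 1 <= 1 + 3 / e%:R :> R by rewrite lerDl divr_ge0.
suff /andP[-> h] : trinomial_peak R e 0 <= trinomial_peak R e r
    <= trinomial_peak R e 0 * (1 + 3 / e%:R) ^+ r.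
  by apply: le_trans h _; rewrite ler_wpM2l // ler_weXn2l.
elim: r r9 => [|r IH] r9; first by rewrite expr0 mulr1 lexx.
have /andP[l1 l2] := IH (ltnW r9).
have r8 : r%:R <= 8 :> R by rewrite (ler_nat R r 8).
have r0 : 0 <= r%:R :> R by [].
have -> : trinomial_peak R e r.+1 = trinomial_peak R e r * (1 + (r%:R + 1) / (3 * e%:R)).
  rewrite /trinomial_peak addnS factS natrM !exprSr -[(3 * e + r).+1%:R]natr1 natrD natrM.
  have h1 : e%:R ^+ r != 0 :> R by rewrite expf_neq0 // lt0r_neq0.
  have h2 : e`!%:R != 0 :> R by rewrite pnatr_eq0 -lt0n fact_gt0.
  have h3 : 3 ^+ (3 * e + r) != 0 :> R by rewrite expf_neq0 // pnatr_eq0.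
  move: e%:R (3 ^+ (3 * e + r)) (e%:R ^+ r) e`!%:R (lt0r_neq0 e0') h1 h2 h3 => x1 x2 x3 x4 h0 h1
    h2 h3.
  by field; rewrite h0 h1 h2 h3.
have d0 : 0 <= (r%:R + 1) / (3 * e%:R) :> R by rewrite divr_ge0 //; lra.
apply/andP; split; first by apply: le_trans l1 _; rewrite ler_peMr // lerDl.
rewrite exprSr mulrA; apply: ler_pM => //.
rewrite lerD2l invfM mulrA ler_wpM2r ?invr_ge0 //.
lra.
Qed.

Let L : R := Num.sqrt 3 / (2 * pi).

Lemma cvg_trinomial_peak (g r : nat -> nat) : g @ \oo --> \oo -> (forall n, (r n <= 9)%N) ->
  (fun n => (g n)%:R * trinomial_peak R (g n) (r n)) @ \oo --> L.
Proof.
move=> goo r9.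
have g0 : \forall n \near \oo, (0 < g n)%N.
  by move/cvgnyPge : goo => /(_ 1%N).
have C : (fun n => (g n)%:R * trinomial_peak R (g n) 0) @ \oo --> L.
  exact: (cvg_comp _ _ goo (@trinomial_peak_cvg R)).
have D : (fun n => (g n)%:R * trinomial_peak R (g n) 0 * (1 + 3 * (g n)%:R^-1) ^+ 9) @ \oo -->
    L * (1 + 3 * 0) ^+ 9.
  apply: cvgM => //; apply: cvg_expr; apply: cvgD; first exact: cvg_cst.
  apply: cvgM; first exact: cvg_cst.
  exact: (cvg_comp _ _ goo cvg_invn).
rewrite mulr0 addr0 expr1n mulr1 in D.
apply: (squeeze_cvgr _ C D); near=> n.
have e0 : (0 < g n)%N by near: n.
have /andP[h1 h2] := trinomial_peak_bounds e0 (r9 n).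
by rewrite -mulrA !ler_wpM2l.
Unshelve. all: by end_near.
Qed.

Let e n := (n %/ 9)%N.
Let r n := (n %% 9)%N.
Let nE n : n = (9 * e n + r n)%N.
Proof. by rewrite mulnC -divn_eq. Qed.
Let r9 n : (r n < 9)%N. Proof. by rewrite ltn_mod. Qed.

Let e_oo : e @ \oo --> \oo.
Proof.
apply/cvgnyPge => A; near=> n; rewrite /e leq_divRL //; near: n.
exact: nbhs_infty_ge.
Unshelve. all: by end_near.
Qed.

Let e3_oo : (fun n => (3 * e n)%N) @ \oo --> \oo.
Proof.
apply/cvgnyPge => A; near=> n; apply: (@leq_trans (e n)); last by rewrite leq_pmull.
by near: n; move/cvgnyPge: e_oo => /(_ A).
Unshelve. all: by end_near.
Qed.

Let e_gt0 : \forall n \near \oo, (0 < e n)%N.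
Proof. by move/cvgnyPge : e_oo => /(_ 1%N). Qed.

Let eps n : R := (e n)%:R^-1 `^ 5^-1.

Let epsP n : (0 < e n)%N -> 0 < eps n /\ (e n)%:R * eps n ^+ 5 = 1.
Proof.
move=> e0; have e0' : 0 < (e n)%:R :> R by rewrite ltr0n.
split; first by apply: powR_gt0; rewrite invr_gt0.
rewrite -powR_mulrn ?powR_ge0 // /eps -powRrM mulVf ?pnatr_eq0 // powRr1 ?invr_ge0 //.
by rewrite divff // lt0r_neq0.
Qed.

Let eps_cvg : eps @ \oo --> 0.
Proof.
apply/cvgr0Pnorm_lt => eta eta0.
have C : (fun n => (e n)%:R^-1 : R) @ \oo --> (0 : R) := cvg_comp _ _ e_oo cvg_invn.
have eta5 : 0 < eta ^+ 5 by rewrite exprn_gt0.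
near=> n.
have e0 : (0 < e n)%N by near: n.
have [p0 pe] := epsP e0.
have : `|(e n)%:R^-1 : R| < eta ^+ 5.
  by near: n; move/cvgr0Pnorm_lt: C => /(_ _ eta5).
rewrite gtr0_norm ?invr_gt0 ?ltr0n // gtr0_norm // !ltNge; apply: contra => h.
have : eta ^+ 5 <= eps n ^+ 5.
  by rewrite lerXn2r ?nnegrE //; exact: ltW.
rewrite -[eps n ^+ 5](mulKf (_ : (e n)%:R != 0)) ?pe ?mulr1 // ?pnatr_eq0 -?lt0n.
Unshelve. all: by end_near.
Qed.

Let scaled_kappa n : R :=
  ((3 * e n)%:R * trinomial_peak R (3 * e n) (r n)) ^+ 3 / 27 /
  ((e n)%:R * trinomial_peak R (e n) (r n)).

Let L0 : L != 0.
Proof. by rewrite mulf_neq0 ?sqrtr_eq0 -?ltNge // invr_eq0 mulf_neq0 // lt0r_neq0 // pi_gt0. Qed.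

Let scaled_kappa_cvg : scaled_kappa @ \oo --> L ^+ 2 / 27.
Proof.
have -> : L ^+ 2 / 27 = L ^+ 3 / 27 / L by move: L L0 => l l0; field.
apply: cvgM; last by apply: cvgV => //; apply: cvg_trinomial_peak => // n; exact: ltnW.
apply: cvgM; last exact: cvg_cst.
by apply: cvg_expr; apply: cvg_trinomial_peak => // n; exact: ltnW.
Qed.

Let Q_cvg : (fun n => (1 - 2 * eps n) ^+ 3) @ \oo --> (1 : R).
Proof.
have : (fun n => (1 - 2 * eps n) ^+ 3) @ \oo --> (1 - 2 * 0 : R) ^+ 3.
  apply: cvg_expr; apply: cvgB; first exact: cvg_cst.
  by apply: cvgM; first exact: cvg_cst.
by rewrite mulr0 subr0 expr1n.
Qed.

Let scaled_sum_cvg : (fun n => (e n)%:R ^+ 2 * trinomial_cube_sum R n) @ \oo --> L ^+ 2 / 27.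
Proof.
pose lo n := (1 - 2 * eps n) ^+ 3 * (scaled_kappa n * (1 - 39 * eps n)).
pose hi n := (scaled_kappa n + ((3 * e n)%:R * trinomial_peak R (3 * e n) (r n)) ^+ 2 / 9 * (39 *
  eps n))
  / (1 - 2 * eps n) ^+ 3.
have loC : lo @ \oo --> 1 * (L ^+ 2 / 27 * (1 - 39 * 0)).
  apply: cvgM => //; apply: cvgM => //; apply: cvgB; first exact: cvg_cst.
  by apply: cvgM; first exact: cvg_cst.
have hiC : hi @ \oo --> (L ^+ 2 / 27 + L ^+ 2 / 9 * (39 * 0)) / 1.
  apply: cvgM; last by apply: cvgV => //; exact: oner_neq0.
  apply: cvgD => //; apply: cvgM; last by apply: cvgM; first exact: cvg_cst.
  apply: cvgM; last exact: cvg_cst.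
  by apply: cvg_expr; apply: cvg_trinomial_peak => // n; exact: ltnW.
rewrite !mulr0 subr0 mulr1 mul1r in loC; rewrite !mulr0 addr0 divr1 in hiC.
apply: (squeeze_cvgr _ loC hiC); near=> n.
have e0 : (0 < e n)%N by near: n.
have e0' : 0 < (e n)%:R :> R by rewrite ltr0n.
have [p0 pe] := epsP e0.
have p1 : 2 * eps n < 1.
  have : `|eps n| < 2^-1 by near: n; move/cvgr0Pnorm_lt: eps_cvg => /(_ 2^-1); apply;
    rewrite invr_gt0.
  by rewrite gtr0_norm //; lra.
have [l u] := trinomial_cube_sum_bounds e0 (r9 n) p0 (ltW p1) pe.
rewrite -nE in l u.
have e2 : 0 <= (e n)%:R ^+ 2 :> R by exact: sqr_ge0.
have kE : scaled_kappa n = (e n)%:R ^+ 2 * (trinomial_peak R (3 * e n) (r n) ^+ 3 /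
  trinomial_peak R (e n) (r n)).
  rewrite /scaled_kappa natrM invfM; move: (lt0r_neq0 e0') (trinomial_peak _ _ _) (trinomial_peak
    _ _ _)^-1.
  by move: (e n)%:R => x x0 y z; field.
apply/andP; split.
  by rewrite /lo kE -[X in _ * X]mulrA mulrCA ler_wpM2l.
rewrite /hi ler_pdivlMr ?exprn_gt0 ?subr_gt0 //.
have -> : ((3 * e n)%:R * trinomial_peak R (3 * e n) (r n)) ^+ 2 / 9 * (39 * eps n) =
   (e n)%:R ^+ 2 * (trinomial_peak R (3 * e n) (r n) ^+ 2 * (39 * eps n)).
  by rewrite natrM; move: (trinomial_peak _ _ _) (eps n) (e n)%:R => x y z; field.
by rewrite kE -mulrDr -mulrA ler_wpM2l // mulrC.
Unshelve. all: by end_near.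
Qed.

Lemma trinomial_cube_sum_cvg :
  (fun n => n%:R ^+ 2 * trinomial_cube_sum R n) @ \oo --> 3 * L ^+ 2.
Proof.
have C : (fun n => n%:R * (e n)%:R^-1 : R) @ \oo --> (9 : R).
  have lo : (fun=> 9 : R) @ \oo --> (9 : R) by exact: cvg_cst.
  have hi : (fun n => 9 + 9 * (e n)%:R^-1 : R) @ \oo --> (9 + 9 * 0 : R).
    apply: cvgD; first exact: cvg_cst.
    apply: cvgM; first exact: cvg_cst.
    exact: (cvg_comp _ _ e_oo cvg_invn).
  rewrite mulr0 addr0 in hi.
  apply: (squeeze_cvgr _ lo hi); near=> n.
  have e0 : (0 < e n)%N by near: n.
  have e0' : 0 < (e n)%:R :> R by rewrite ltr0n.
  have r0 : 0 <= (r n)%:R :> R by [].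
  have r1 : (r n)%:R <= 9 :> R by rewrite (ler_nat R _ 9) ltnW.
  have := nE n => /(congr1 (fun i => i%:R : R)); rewrite natrD natrM => ->.
  have -> : 9 + 9 / (e n)%:R = (9 * (e n)%:R + 9) / (e n)%:R :> R.
    by move: (e n)%:R (lt0r_neq0 e0') => x x0; field.
  by rewrite ler_pdivlMr // lerDl r0 /= ler_wpM2r ?invr_ge0 // lerD2l.
have : (fun n => (n%:R * (e n)%:R^-1) ^+ 2 * ((e n)%:R ^+ 2 * trinomial_cube_sum R n)) @ \oo
    --> 9 ^+ 2 * (L ^+ 2 / 27).
  by apply: cvgM; [exact: (cvg_expr (k := 2) C)|exact: scaled_sum_cvg].
have -> : 9 ^+ 2 * (L ^+ 2 / 27) = 3 * L ^+ 2 by move: L => l; field.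
apply: cvg_trans; apply: near_eq_cvg; near=> n.
have e0 : (0 < e n)%N by near: n.
have e0' : (e n)%:R != 0 :> R by rewrite lt0r_neq0 // ltr0n.
move: (trinomial_cube_sum R n) => s.
by move: (e n)%:R e0' n%:R => x x0 y; field.
Unshelve. all: by end_near.
Qed.

Lemma trinomial_peak_cube_sum_cvg :
  (fun n => n%:R ^+ 3 * (trinomial_peak R n 0 * trinomial_cube_sum R n)) @ \oo -->
    9 * Num.sqrt 3 / (8 * pi ^+ 3).
Proof.
have C : (fun n => (n%:R * trinomial_peak R n 0) * (n%:R ^+ 2 * trinomial_cube_sum R n)) @ \oo
   --> L * (3 * L ^+ 2).
  by apply: cvgM; [exact: trinomial_peak_cvg|exact: trinomial_cube_sum_cvg].
have LE : L * (3 * L ^+ 2) = 9 * Num.sqrt 3 / (8 * pi ^+ 3).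
  have s2 : Num.sqrt 3 ^+ 2 = 3 :> R by rewrite sqr_sqrtr.
  have -> : L * (3 * L ^+ 2) = 3 * Num.sqrt 3 * (Num.sqrt 3 ^+ 2) / (8 * pi ^+ 3).
    by rewrite /L; move: (@pi R) (lt0r_neq0 (pi_gt0 R)) => q q0; field.
  by rewrite s2; move: (@pi R) (lt0r_neq0 (pi_gt0 R)) => q q0; field.
rewrite LE in C.
suff -> : (fun n => n%:R ^+ 3 * (trinomial_peak R n 0 * trinomial_cube_sum R n)) =
  (fun n => (n%:R * trinomial_peak R n 0) * (n%:R ^+ 2 * trinomial_cube_sum R n)) by [].
by apply/funext => n; ring.
Qed.

End CubeSumLimit.

(** * Relations between roots of unity of prime order *)

Section RootsOfUnity.
Implicit Types (p : nat).

Lemma unity_prime_primitive (F : fieldType) p (z : F) : prime p -> z ^+ p = 1 -> z != 1 ->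
  p.-primitive_root z.
Proof.
move=> pp zp z1; have [m zm] := prim_order_exists (prime_gt0 pp) zp.
have m1 : m != 1%N by apply: contraNneq z1 => m1; rewrite -(expr1 z) -m1 prim_expr_order.
by move=> /(prime_nt_dvdP pp m1) <-.
Qed.

Let geom p : {poly rat} := \poly_(c < p) 1.

Let geomE p (F : numFieldType) (x : F) : (map_poly ratr (geom p)).[x] = \sum_(c < p) x ^+ c.
Proof.
rewrite /geom poly_def rmorph_sum /= horner_sum; apply: eq_bigr => i _.
by rewrite scale1r map_polyXn hornerXn.
Qed.

Let geom_root p (F : numFieldType) (x : F) : prime p ->
  root (map_poly ratr (geom p)) x = (x ^+ p == 1) && (x != 1).
Proof.
move=> pp; rewrite rootE geomE; have [->|x1] := eqVneq x 1.
  under eq_bigr do rewrite expr1n.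
  by rewrite andbF sumr_const card_ord pnatr_eq0 eqn0Ngt prime_gt0.
by rewrite andbT -[in RHS]subr_eq0 subrX1 mulf_eq0 subr_eq0 (negPf x1).
Qed.

Let size_geom p : prime p -> size (geom p) = p.
Proof. by move=> pp; rewrite size_poly_eq // oner_neq0. Qed.

Lemma prime_relation (C : numFieldType) p (w : C) (nu : 'I_p -> nat) :
  prime p -> w ^+ p = 1 -> w != 1 -> \sum_(c < p) (nu c)%:R * w ^+ c = 0 ->
  forall c d, nu c = nu d.
Proof.
move=> pp wp w1 nu0.
pose q : {poly rat} := \poly_(c < p) (if insub c is Some i then (nu i)%:R else 0).
have qE (c : 'I_p) : q`_c = (nu c)%:R by rewrite coef_poly ltn_ord insubT //= => h;
  congr (nu _)%:R; apply: val_inj.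
have qw : root (map_poly ratr q) w.
  rewrite rootE -[X in _ == X]nu0 /q poly_def rmorph_sum /= horner_sum; apply/eqP/eq_bigr => i _.
  rewrite linearZ /= map_polyXn hornerZ hornerXn insubT //= => h.
  by rewrite ratr_nat; congr ((nu _)%:R * _); apply: val_inj.
have gw : root (map_poly ratr (geom p)) w by rewrite geom_root // wp eqxx.
have g0 : geom p != 0 by rewrite -size_poly_gt0 size_geom // prime_gt0.
have dw : root (map_poly ratr (gcdp q (geom p))) w by rewrite gcdp_map root_gcd qw gw.
have d0 : gcdp q (geom p) != 0 by rewrite gcdp_eq0 negb_and g0 orbT.
have dsz : size (map_poly (ratr : rat -> algC) (gcdp q (geom p))) != 1.
  rewrite size_map_poly; apply: contraTneq dw => /eqP; rewrite size_poly_eq1.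
  rewrite -(eqp_map (ratr : rat -> C)) rmorph1 => /eqp_root ->.
  exact: root1.
have [z] := closed_rootP _ dsz; rewrite gcdp_map root_gcd => /andP[qz gz].
have zp : p.-primitive_root z.
  by move: gz; rewrite geom_root // => /andP[/eqP ? ?]; exact: unity_prime_primitive.
have [q0 [q0E _] q0P] := minCpolyP z.
have q0_size : size q0 = p.
  rewrite -(size_map_poly (ratr : rat -> algC)) -q0E (minCpoly_cyclotomic zp) size_cyclotomic.
  by rewrite totient_prime // prednK // prime_gt0.
have q0g : q0 %= geom p by rewrite -dvdp_size_eqp -?q0P // q0_size size_geom.
have : geom p %| q by rewrite -(eqp_dvdl _ q0g) -q0P.
move=> /dvdpP[k kE].
have [k0|k0] := eqVneq k 0.
  have nu_eq0 c : nu c = 0%N.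
    by apply/eqP; rewrite -(pnatr_eq0 rat) -qE kE k0 mul0r coef0.
  by move=> c d; rewrite !nu_eq0.
have k1 : (size k <= 1)%N.
  have : (size q <= p)%N by exact: size_poly.
  rewrite kE size_mul // size_geom //; have := prime_gt0 pp.
  by move: (size k) => i; clear; lia.
move=> c d; apply/eqP; rewrite -(eqr_nat rat) -!qE kE (size1_polyC k1) !coefCM.
by rewrite !coef_poly !ltn_ord.
Qed.

End RootsOfUnity.

Section ButsonW.
Variable R : realType.

Lemma Butson_wX p k : Butson_w R p ^+ k =
  Complex (cos (k%:R * (2 * pi / p%:R))) (sin (k%:R * (2 * pi / p%:R))).
Proof.
elim: k => [|k IH]; first by rewrite expr0 mul0r cos0 sin0.
rewrite exprS IH /Butson_w -[k.+1%:R]natr1 [(k%:R + 1) * _]mulrDl mul1r sinD cosD.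
apply/eqP; rewrite eq_complex /=; apply/andP; split; apply/eqP; ring.
Qed.

Lemma Butson_w_expr p : (0 < p)%N -> Butson_w R p ^+ p = 1.
Proof.
move=> p0; rewrite Butson_wX.
have -> : p%:R * (2 * pi / p%:R) = pi *+ 2 :> R.
  have : p%:R != 0 :> R by rewrite pnatr_eq0 -lt0n.
  by rewrite mulr2n; move: (@pi R) p%:R => q x x0; field.
by rewrite cos2pi sin2pi.
Qed.

Lemma Butson_w_neq1 p : (1 < p)%N -> Butson_w R p != 1.
Proof.
move=> p1; have p0 : 0 < p%:R :> R by rewrite ltr0n ltnW.
apply/eqP => /(congr1 (@complex.Re R)) /= E.
have : 2 * pi / p%:R = 0 :> R.
  have le : 2 * pi / p%:R <= pi :> R.
    rewrite ler_pdivrMr // mulrC ler_wpM2l ?pi_ge0 //.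
    by rewrite (ler_nat R 2 p).
  apply: (@cos_inj R); rewrite ?in_itv /= ?lexx ?pi_ge0 ?le ?E ?cos0 // andbT.
  by rewrite divr_ge0 ?mulr_ge0 ?pi_ge0.
by apply/eqP; rewrite gt_eqF // divr_gt0 // mulr_gt0 // pi_gt0.
Qed.

Lemma conj_unity_root (C : numClosedFieldType) p (z : C) : (0 < p)%N -> z ^+ p = 1 -> z^* = z^-1.
Proof.
move=> p0 zp; have n1 : `|z| = 1.
  by apply/eqP; rewrite -(pexpr_eq1 p0) // -normrX zp normr1.
by rewrite invC_norm n1 expr1n invr1 mul1r.
Qed.
Lemma unity_rootP_Butson p (z : R[i]) : prime p -> p.-unity_root z ->
  exists a : 'I_p, z = Butson_w R p ^+ a.
Proof.
move=> pp /unity_rootP zp.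
have prim := unity_prime_primitive pp (Butson_w_expr (prime_gt0 pp)) (Butson_w_neq1 (prime_gt1
  pp)).
by have [a ->] := prim_rootP prim zp; exists a.
Qed.

Lemma Butson_w_inj p : prime p -> injective (fun a : 'I_p => Butson_w R p ^+ a).
Proof.
move=> pp a b /eqP.
have prim := unity_prime_primitive pp (Butson_w_expr (prime_gt0 pp)) (Butson_w_neq1 (prime_gt1
  pp)).
by rewrite (eq_prim_root_expr prim) !modn_small // => /eqP/val_inj.
Qed.

Definition equidistributed p N (g : 'I_N -> 'I_p) : Prop :=
  forall c, (p * #|[set k | g k == c]%SET|)%N = N.

Lemma sum_fibres p N (g : 'I_N -> 'I_p) (F : 'I_p -> R[i]) :
  \sum_k F (g k) = \sum_c (#|[set k | g k == c]%SET|)%:R * F c.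
Proof.
rewrite (partition_big g xpredT) //=; apply: eq_bigr => c _.
rewrite (eq_bigr (fun=> F c)) => [|k /eqP -> //].
by rewrite sumr_const mulr_natl; congr (_ *+ _); rewrite cardsE.
Qed.

Lemma sum_card_fibres (I J : finType) (g : I -> J) : \sum_c #|[set k | g k == c]%SET| = #|I|.
Proof.
rewrite -sum1_card (partition_big g xpredT) //=; apply: eq_bigr => c _.
by rewrite sum1dep_card.
Qed.

Lemma sum_Butson_w_eq0 p N (g : 'I_N -> 'I_p) : prime p ->
  (\sum_k Butson_w R p ^+ g k = 0) <-> equidistributed g.
Proof.
move=> pp; have wp := Butson_w_expr (prime_gt0 pp); have w1 := Butson_w_neq1 (prime_gt1 pp).
rewrite (sum_fibres g (fun c => Butson_w R p ^+ c)); split.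
  move=> /(prime_relation pp wp w1) E c.
  apply: etrans (etrans (sum_card_fibres g) (card_ord N)).
  by rewrite (eq_bigr (fun=> #|[set k | g k == c]%SET|)) ?sum_nat_const ?card_ord.
move=> E; have nE c c' : #|[set k | g k == c]%SET| = #|[set k | g k == c']%SET|.
  by apply/eqP; rewrite -(eqn_pmul2l (prime_gt0 pp)) !E.
pose c0 := Ordinal (prime_gt0 pp); rewrite (eq_bigr (fun c : 'I_p => (#|[set k | g k ==
  c0]%SET|)%:R * Butson_w R p ^+ c)).
  rewrite -mulr_sumr; apply/eqP; rewrite mulf_eq0; apply/orP; right.
  have /eqP : (Butson_w R p - 1) * (\sum_(i < p) Butson_w R p ^+ i) = 0 by rewrite -subrX1 wp
    subrr.
  by rewrite mulf_eq0 subr_eq0 (negPf w1).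
by move=> c _; rewrite (nE c c0).
Qed.

Definition ord_diff p (a b : 'I_p) : 'I_p :=
  Ordinal (ltn_pmod (a + (p - b)) (leq_ltn_trans (leq0n a) (ltn_ord a))).

Lemma Butson_w_diff p (a b : 'I_p) : prime p ->
  Butson_w R p ^+ ord_diff a b = Butson_w R p ^+ a * (Butson_w R p ^+ b)^*.
Proof.
move=> pp; have wp := Butson_w_expr (prime_gt0 pp).
rewrite /= (expr_mod _ wp) exprD; congr (_ * _).
rewrite (@conj_unity_root _ p) ?prime_gt0 //; last by rewrite exprAC wp expr1n.
have w0 : Butson_w R p != 0.
  by apply/eqP => w0; move/eqP: wp; rewrite w0 expr0n gtn_eqF ?prime_gt0 // eq_sym oner_eq0.
by rewrite -[LHS](mulfK (expf_neq0 b w0)) -exprD subnK ?wp ?mul1r // ltnW.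
Qed.

End ButsonW.

(** * Orthogonality and multiplicities *)

Section Fibres.

Lemma card_set_sum (I : finType) (P : pred I) : #|[set k | P k]%SET| = (\sum_k P k)%N.
Proof. by rewrite -sum1dep_card big_mkcond. Qed.

Lemma count_tnth (T : eqType) N (t : N.-tuple T) (P : pred T) :
  #|[set k | P (tnth t k)]%SET| = count P t.
Proof. by rewrite card_set_sum -(big_tuple _ _ t xpredT (fun x => nat_of_bool (P x))) -sum1_count
  [in RHS]big_mkcond. Qed.

Lemma exists_fibres (T : finType) (nu : T -> nat) N : (\sum_t nu t)%N = N ->
  exists g : 'I_N -> T, forall t, #|[set k | g k == t]%SET| = nu t.
Proof.
move=> nuN; pose s := flatten [seq nseq (nu t) t | t <- enum T].
have sN : size s == N.
  by rewrite size_flatten /shape -map_comp sumnE big_map -nuN big_enum /=;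
     apply/eqP/eq_bigr => t _; rewrite size_nseq.
exists (tnth (Tuple sN)) => x; rewrite (count_tnth _ (pred1 x)) /= count_flatten -map_comp sumnE
  big_map big_enum /=.
rewrite (bigD1 x) //= count_nseq /= eqxx mul1n big1 ?addn0 // => t /negPf tx.
by rewrite count_nseq /= tx.
Qed.

Lemma perm_of_fibres (T : finType) N (g h : 'I_N -> T) :
  (forall t, #|[set k | g k == t]%SET| = #|[set k | h k == t]%SET|) ->
  exists s : 'S_N, forall k, h k = g (s k).
Proof.
move=> gh.
have cardE (f : 'I_N -> T) t : count_mem t [tuple f k | k < N] = #|[set k | f k == t]%SET|.
  by rewrite -count_tnth; apply: eq_card => k; rewrite !inE /= tnth_mktuple.
have : perm_eq [tuple h k | k < N] [tuple g k | k < N].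
  by apply/allP => t _ /=; rewrite !cardE gh.
move=> /tuple_permP[s hs]; exists s => k.
have := congr1 (fun u => nth (h k) u k) hs.
by rewrite -!tnth_nth !tnth_mktuple.
Qed.

Lemma card_fibre_split (I J : finType) (P : pred I) (b : I -> J) :
  (\sum_j #|[set k | P k && (b k == j)]%SET|)%N = #|[set k | P k]%SET|.
Proof.
rewrite -sum1dep_card (partition_big b xpredT) //=; apply: eq_bigr => j _.
by rewrite sum1dep_card.
Qed.

Lemma card_fibre_rel (I J K : finType) (a : I -> J) (b : I -> K) (Q : J -> K -> bool) :
  (\sum_i \sum_(j | Q i j) #|[set k | (a k == i) && (b k == j)]%SET|)%N = #|[set k | Q (a k) (b
    k)]%SET|.
Proof.
rewrite -sum1dep_card (partition_big a xpredT) //=; apply: eq_bigr => i _.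
rewrite (partition_big b (Q i)) => [|k /andP[h /eqP <-] //].
apply: eq_bigr => j Qij; rewrite sum1dep_card; apply: eq_card => k; rewrite !inE.
have [->|] := eqVneq (a k) i; rewrite ?andbF //=.
by have [->|] := eqVneq (b k) j; rewrite ?andbF // Qij.
Qed.

End Fibres.

Section Criterion.
Variable R : realType.

Definition i0 : 'I_3 := @Ordinal 3 0 isT.
Definition i1 : 'I_3 := @Ordinal 3 1 isT.
Definition i2 : 'I_3 := @Ordinal 3 2 isT.

Lemma ord3_ind (P : 'I_3 -> Prop) : P i0 -> P i1 -> P i2 -> forall i, P i.
Proof.
move=> P0 P1 P2 [[|[|[|//]]] hi].
- by rewrite (_ : Ordinal hi = i0) //; apply: val_inj.
- by rewrite (_ : Ordinal hi = i1) //; apply: val_inj.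
- by rewrite (_ : Ordinal hi = i2) //; apply: val_inj.
Qed.

Lemma ord3_lt_ind (P : 'I_3 -> 'I_3 -> Prop) : P i1 i0 -> P i2 i0 -> P i2 i1 ->
  forall i j : 'I_3, (j < i)%N -> P i j.
Proof. by move=> P10 P20 P21; elim/ord3_ind; elim/ord3_ind. Qed.

Lemma dot_rowE M N (H : 'M[R[i]]_(M, N)) i j :
  dotmx (row i H) (row j H) = \sum_k H i k * (H j k)^*.
Proof. by rewrite dotmxE !mxE; apply: eq_bigr => k _; rewrite !mxE. Qed.

Lemma partial_Butson_exponents p N (H : 'M[R[i]]_(3, N)) (E : 'I_3 -> 'I_N -> 'I_p) :
  prime p -> (forall i k, H i k = Butson_w R p ^+ E i k) ->
  partial_Butson p H <->
  [/\ equidistributed (fun k => ord_diff (E i1 k) (E i0 k)),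
      equidistributed (fun k => ord_diff (E i2 k) (E i0 k)) &
      equidistributed (fun k => ord_diff (E i2 k) (E i1 k))].
Proof.
move=> pp HE.
have dotP i j : dotmx (row i H) (row j H) = 0 <-> equidistributed (fun k => ord_diff (E i k) (E j
  k)).
  rewrite -(sum_Butson_w_eq0 R) // dot_rowE.
  have -> // : \sum_k H i k * (H j k)^* = \sum_k Butson_w R p ^+ (ord_diff (E i k) (E j k)).
  by apply: eq_bigr => k _; rewrite Butson_w_diff // !HE.
split => [[_ orth]|[/dotP d10 /dotP d20 /dotP d21]]; first by split; apply/dotP; apply: orth.
split => [i j|].
  apply/unity_rootP.
  by rewrite HE exprAC Butson_w_expr ?prime_gt0 // expr1n.
have lt_dot := @ord3_lt_ind (fun i j => dotmx (row i H) (row j H) = 0) d10 d20 d21.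
move=> i j; rewrite -val_eqE neq_ltn => /orP[/lt_dot|/lt_dot //].
rewrite !dot_rowE => /(congr1 (fun z : R[i] => z^*)); rewrite conjC0 rmorph_sum /= => dji;
  rewrite -[RHS]dji.
by apply: eq_bigr => k _ /=; rewrite rmorphM /= conjCK mulrC.
Qed.

Section Dephased.
Variables (p N : nat).
Hypothesis (pp : prime p).

Lemma dephased_exponents (H : 'M[R[i]]_(3, N)) : mx_unity p H -> dephased H ->
  exists a b : 'I_N -> 'I_p, forall k,
   [/\ H i0 k = 1, H i1 k = Butson_w R p ^+ a k & H i2 k = Butson_w R p ^+ b k].
Proof.
move=> Hu Hd.
have [a aE] := @boolp.choice _ _ (fun k c => H i1 k = Butson_w R p ^+ (c : 'I_p))
  (fun k => unity_rootP_Butson pp (Hu i1 k)).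
have [b bE] := @boolp.choice _ _ (fun k c => H i2 k = Butson_w R p ^+ (c : 'I_p))
  (fun k => unity_rootP_Butson pp (Hu i2 k)).
exists a, b => k; split=> //; rewrite -(Hd k); congr (H _ k); exact: val_inj.
Qed.

Variables (H : 'M[R[i]]_(3, N)) (a b : 'I_N -> 'I_p).
Hypothesis HE : forall k,
  [/\ H i0 k = 1, H i1 k = Butson_w R p ^+ a k & H i2 k = Butson_w R p ^+ b k].

Lemma multiplicity_exponents i j :
  multiplicity_mx p H i j = #|[set k | (a k == i) && (b k == j)]%SET|.
Proof.
rewrite mxE; apply: eq_card => k; rewrite !inE.
have [E0 E1 E2] := HE k; have inj := @Butson_w_inj R p pp.
apply/eqP/andP => [/colP E|[/eqP ai /eqP bj]].
  by split; apply/eqP/inj; rewrite -?E1 -?E2; [have := E i1|have := E i2]; rewrite !mxE.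
apply/colP; elim/ord3_ind; rewrite !mxE /=.
- exact: E0.
- by rewrite -ai.
- by rewrite -bj.
Qed.

Lemma partial_Butson_dephased : partial_Butson p H <->
  [/\ equidistributed a, equidistributed b & equidistributed (fun k => ord_diff (b k) (a k))].
Proof.
have p0 := prime_gt0 pp.
pose E (i : 'I_3) k := if i == i0 then Ordinal p0 else if i == i1 then a k else b k.
have d0 c : ord_diff c (Ordinal p0) = c.
  by apply: val_inj; rewrite /= subn0 modnDr modn_small.
have := @partial_Butson_exponents p N H E pp; rewrite /E /=.
have Ed (c : 'I_N -> 'I_p) : (fun k => ord_diff (c k) (Ordinal p0)) = c by apply/funext => k.
rewrite (Ed a) (Ed b); apply; elim/ord3_ind => k; have [E0 E1 E2] := HE k.
- exact: E0.
- exact: E1.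
- exact: E2.
Qed.

Let ratP m : (m%:R = N%:R / p%:R :> rat) <-> (p * m)%N = N.
Proof.
have p0 : p%:R != 0 :> rat by rewrite pnatr_eq0 -lt0n prime_gt0.
split => [E|<-]; last by rewrite natrM mulrC mulKf.
by apply/eqP; rewrite -(eqr_nat rat) natrM E mulrC divfK.
Qed.

Lemma tristochastic_dephased : tristochastic (N%:R / p%:R) (multiplicity_mx p H) <->
  [/\ equidistributed a, equidistributed b & equidistributed (fun k => ord_diff (b k) (a k))].
Proof.
have rowE i : (\sum_(j < p) multiplicity_mx p H i j)%N = #|[set k | a k == i]%SET|.
  under eq_bigr do rewrite multiplicity_exponents.
  exact: card_fibre_split.
have colE j : (\sum_(i < p) multiplicity_mx p H i j)%N = #|[set k | b k == j]%SET|.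
  under eq_bigr do rewrite multiplicity_exponents.
  rewrite -(card_fibre_split (fun k => b k == j) a).
  by apply: eq_bigr => i _; apply: eq_card => k; rewrite !inE andbC.
have diagE (c : 'I_p) : (\sum_(i < p) \sum_(j < p | j == i + c %[mod p]) multiplicity_mx p H i
  j)%N =
    #|[set k | ord_diff (b k) (a k) == c]%SET|.
  under eq_bigr do under eq_bigr do rewrite multiplicity_exponents.
  rewrite (card_fibre_rel a b (fun i j => j == i + c %[mod p])).
  apply: eq_card => k; rewrite !inE -val_eqE /=.
  rewrite -[X in _ = (_ == X)](modn_small (ltn_ord c)) -[RHS](eqn_modDr (a k)) -[in RHS]addnA
    subnK 1?ltnW //.
  by rewrite modnDr [(c + _)%N]addnC.
split => [[h1 h2 h3]|[h1 h2 h3]]; split => c.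
- by apply/ratP; rewrite -rowE; exact: h1.
- by apply/ratP; rewrite -colE; exact: h2.
- by apply/ratP; rewrite -diagE; exact: h3.
- by rewrite rowE; apply/ratP; exact: h1.
- by rewrite colE; apply/ratP; exact: h2.
- by rewrite diagE; apply/ratP; exact: h3.
Qed.

End Dephased.
End Criterion.

Section Classification.
Variable R : realType.
Variables (p N : nat).
Hypothesis pp : prime p.
Implicit Types H : 'M[R[i]]_(3, N).

Lemma dephased_criterion H : mx_unity p H -> dephased H ->
  (partial_Butson p H <-> tristochastic (N%:R / p%:R) (multiplicity_mx p H)).
Proof.
move=> Hu Hd; have [a [b HE]] := dephased_exponents pp Hu Hd.
exact: iff_trans (partial_Butson_dephased pp HE) (iff_sym (tristochastic_dephased pp HE)).
Qed.

Lemma multiplicity_mx_image : (@multiplicity_mx R p N) @`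
  [set H : 'M[R[i]]_(3, N) | dephased H /\ partial_Butson p H] = @tristochastic p (N%:R / p%:R).
Proof.
apply/seteqP; split => [A /= [H [Hd HB] <-]|A At /=].
  by apply/dephased_criterion => //; case: HB.
have [rowA _ _] := At.
have AN : (\sum_(t : 'I_p * 'I_p) A t.1 t.2)%N = N.
  rewrite -(pair_bigA _ (fun i j => A i j)) /=; apply/eqP; rewrite -(eqr_nat rat) natr_sum.
  rewrite (eq_bigr (fun=> N%:R / p%:R)) => [|i _]; last exact: rowA.
  rewrite sumr_const card_ord -[_ *+ p]mulr_natr divfK //.
  by rewrite pnatr_eq0 -lt0n prime_gt0.
have [g gE] := exists_fibres AN.
pose H : 'M[R[i]]_(3, N) := \matrix_(i, k)
  [:: 1; Butson_w R p ^+ (g k).1; Butson_w R p ^+ (g k).2]`_i.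
have HE k : [/\ H i0 k = 1, H i1 k = Butson_w R p ^+ (g k).1 & H i2 k = Butson_w R p ^+ (g k).2].
  by split; rewrite mxE.
have HA : multiplicity_mx p H = A.
  apply/matrixP => i j; rewrite (multiplicity_exponents pp HE) -(gE (i, j)).
  by apply: eq_card => k; rewrite !inE; case: (g k) => x y.
exists H => //; split => [k|]; first by rewrite mxE.
apply/(partial_Butson_dephased pp HE)/(tristochastic_dephased pp HE).
by rewrite HA.
Qed.

Lemma multiplicity_mx_perm H H' :
  dephased H -> partial_Butson p H -> dephased H' -> partial_Butson p H' ->
  (multiplicity_mx p H = multiplicity_mx p H' <-> exists s : 'S_N, H' = col_perm s H).
Proof.
move=> Hd [Hu _] Hd' [Hu' _].
have [a [b HE]] := dephased_exponents pp Hu Hd.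
have [a' [b' HE']] := dephased_exponents pp Hu' Hd'.
split => [E|[s ->]]; last first.
  apply/matrixP => i j; rewrite !mxE -(card_preimset _ (@perm_inj _ s)).
  apply: eq_card => k; rewrite !inE; congr (_ == _).
  by apply/colP => r; rewrite !mxE.
have [t|s sE] := @perm_of_fibres ('I_p * 'I_p)%type N (fun k => (a k, b k)) (fun k => (a' k, b'
  k)).
  have := congr1 (fun A : 'M[nat]_p => A t.1 t.2) E.
  rewrite /= (multiplicity_exponents pp HE) (multiplicity_exponents pp HE').
  by case: t => x y /=.
exists s; apply/matrixP => i k; rewrite mxE.
have [A0 A1 A2] := HE (s k); have [B0 B1 B2] := HE' k; have [ak bk] := sE k.
elim/ord3_ind: i; first by rewrite A0 B0.
  by rewrite A1 B1 ak.
by rewrite A2 B2 bk.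
Qed.

End Classification.

(** * Counting *)

Section Counting.

Lemma card_tuple_cons (T : finType) N (P : pred (N.+1.-tuple T)) :
  #|[set t | P t]%SET| = (\sum_x #|[set t : N.-tuple T | P (cons_tuple x t)]%SET|)%N.
Proof.
rewrite -sum1dep_card (reindex (fun u : T * N.-tuple T => cons_tuple u.1 u.2)) /=; last first.
  exists (fun t => (thead t, behead_tuple t)) => [[x t] _|t _].
    by rewrite theadE; congr (_, _); apply: val_inj.
  by rewrite [RHS]tuple_eta; apply: val_inj.
rewrite -(pair_big_dep xpredT (fun x t => P (cons_tuple x t)) (fun _ _ => 1%N)) /=.
by apply: eq_bigr => x _; rewrite sum1dep_card.
Qed.

Lemma multinomial_count (T : finType) N (nu : T -> nat) : (\sum_x nu x)%N = N ->
  (#|[set t : N.-tuple T | [forall x, count_mem x t == nu x]]%SET| * \prod_x (nu x)`! = N`!)%N.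
Proof.
elim: N nu => [|N IH] nu nuN.
  have nu0 x : nu x = 0%N by apply/eqP; move/eqP: nuN; rewrite sum_nat_eq0 => /forallP/(_ x).
  rewrite big1 ?muln1 => [|x _]; last by rewrite nu0 fact0.
  rewrite (_ : [set t | _]%SET = finset.setT) ?cardsT ?card_tuple ?expn0 //.
  by apply/setP => t; rewrite !inE tuple0; apply/forallP => x; rewrite nu0.
rewrite card_tuple_cons big_distrl /= factS -{1}nuN big_distrl /=.
apply: eq_bigr => x _; have [nx|nx] := posnP (nu x).
  rewrite nx mul0n (_ : [set t | _]%SET = finset.set0) ?cards0 ?mul0n //.
  apply/setP => t; rewrite !inE; apply/negP => /forallP/(_ x) /=.
  by rewrite nx eqxx.
pose nu' y := (nu y - (y == x))%N.
have nuE y : nu y = ((x == y) + nu' y)%N.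
  by rewrite /nu'; have [<-|_] := eqVneq x y; rewrite ?subnKC ?subn0.
have nu'N : (\sum_y nu' y)%N = N.
  move: nuN; under eq_bigr do rewrite nuE; rewrite big_split /= (bigD1 x) //= eqxx.
  by rewrite big1 ?addn0 => [|y /negPf yx]; [case|rewrite eq_sym yx].
rewrite -(IH _ nu'N) mulnCA; congr (_ * _)%N.
  by apply: eq_card => t; rewrite !inE; apply: eq_forallb => y /=; rewrite nuE eqn_add2l.
rewrite (bigD1 x) // [in RHS](bigD1 x) //= mulnA; congr (_ * _)%N.
  by rewrite /nu' eqxx subn1 -{1}(prednK nx) factS prednK.
by apply: eq_bigr => y /negPf yx; rewrite /nu' yx subn0.
Qed.

Lemma card_fset_set_image (T : finType) (M : choiceType) (f : T -> M) (P : pred T) :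
  injective f -> #|` fset_set (f @` [set t | P t]) | = #|P|.
Proof.
move=> fI; rewrite (_ : f @` _ = [set` [fset x in [seq f t | t in P]]%fset]).
  by rewrite set_fsetK card_fseq undup_id ?size_image // map_inj_uniq ?enum_uniq.
apply/seteqP; split => x /=.
  move=> [t Pt <-]; rewrite in_fset /=.
  by apply/fintype.imageP; exists t.
rewrite in_fset /=. by move=> /fintype.imageP[t Pt ->]; exists t.
Qed.

End Counting.

Section ThreeClasses.
Variables (N n : nat).
Hypothesis N3 : N = (3 * n)%N.
Implicit Types t : N.-tuple ('I_3 * 'I_3).

Let cnt t i j := count_mem (i, j) t.

Lemma big_ord3 (F : 'I_3 -> nat) : (\sum_i F i = F i0 + F i1 + F i2)%N.
Proof.
rewrite !big_ord_recl big_ord0 addn0 addnA.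
by congr (F _ + F _ + F _)%N; apply: val_inj.
Qed.

Lemma big_ord3_cond (P : pred 'I_3) (F : 'I_3 -> nat) : (\sum_(i | P i) F i =
  (if P i0 then F i0 else 0) + (if P i1 then F i1 else 0) + (if P i2 then F i2 else 0))%N.
Proof. by rewrite big_mkcond big_ord3. Qed.

Definition balanced t : bool :=
  [&& [forall c, 3 * #|[set k | (tnth t k).1 == c]%SET| == N],
      [forall c, 3 * #|[set k | (tnth t k).2 == c]%SET| == N] &
      [forall c, 3 * #|[set k | ord_diff (tnth t k).2 (tnth t k).1 == c]%SET| == N]]%N.

Definition diagonal_mx (a b c : nat) (u : 'I_3 * 'I_3) : nat :=
  nth 0%N [:: a; b; c] ((u.1 + u.2) %% 3).

Let cntE t i j : #|[set k | ((tnth t k).1 == i) && ((tnth t k).2 == j)]%SET| = cnt t i j.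
Proof.
rewrite /cnt -(count_tnth t (pred1 (i, j))); apply: eq_card => k; rewrite !inE /=.
by case: (tnth t k).
Qed.

Let forall3 (P : pred 'I_3) : [forall c, P c] = [&& P i0, P i1 & P i2].
Proof.
apply/forallP/and3P => [h|[h0 h1 h2]]; first by split; apply: h.
by elim/ord3_ind.
Qed.

Let balancedE t : balanced t =
  [&& [&& cnt t i0 i0 + cnt t i0 i1 + cnt t i0 i2 == n,
          cnt t i1 i0 + cnt t i1 i1 + cnt t i1 i2 == n &
          cnt t i2 i0 + cnt t i2 i1 + cnt t i2 i2 == n],
      [&& cnt t i0 i0 + cnt t i1 i0 + cnt t i2 i0 == n,
          cnt t i0 i1 + cnt t i1 i1 + cnt t i2 i1 == n &
          cnt t i0 i2 + cnt t i1 i2 + cnt t i2 i2 == n] &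
      [&& cnt t i0 i0 + cnt t i1 i1 + cnt t i2 i2 == n,
          cnt t i0 i1 + cnt t i1 i2 + cnt t i2 i0 == n &
          cnt t i0 i2 + cnt t i1 i0 + cnt t i2 i1 == n]]%N.
Proof.
have row c : #|[set k | (tnth t k).1 == c]%SET| = (cnt t c i0 + cnt t c i1 + cnt t c i2)%N.
  by rewrite -(card_fibre_split _ (fun k => (tnth t k).2)) big_ord3 !cntE.
have col c : #|[set k | (tnth t k).2 == c]%SET| = (cnt t i0 c + cnt t i1 c + cnt t i2 c)%N.
  rewrite -(card_fibre_split _ (fun k => (tnth t k).1)) big_ord3 -!cntE.
  by congr (_ + _ + _)%N; apply: eq_card => k; rewrite !inE andbC.
have diag c : #|[set k | ord_diff (tnth t k).2 (tnth t k).1 == c]%SET| =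
    (\sum_i \sum_(j | ord_diff j i == c) cnt t i j)%N.
  rewrite -(card_fibre_rel (fun k => (tnth t k).1) (fun k => (tnth t k).2) (fun i j => ord_diff j
    i == c)).
  by apply: eq_bigr => i _; apply: eq_bigr => j _; rewrite cntE.
rewrite /balanced !forall3 !row !col !diag N3 !eqn_pmul2l //.
rewrite !big_ord3; congr [&& _, _ & _].
by rewrite !big_ord3_cond /= !addn0 !add0n.
Qed.

Let diagonalE t a b c : [forall u, count_mem u t == diagonal_mx a b c u] =
  [&& [&& cnt t i0 i0 == a, cnt t i0 i1 == b & cnt t i0 i2 == c],
      [&& cnt t i1 i0 == b, cnt t i1 i1 == c & cnt t i1 i2 == a] &
      [&& cnt t i2 i0 == c, cnt t i2 i1 == a & cnt t i2 i2 == b]]%N.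
Proof.
apply/forallP/and3P => [h|[/and3P[h1 h2 h3] /and3P[h4 h5 h6] /and3P[h7 h8 h9]] [i j]].
  split; apply/and3P; split; rewrite /cnt ?(eqP (h _)) //.
by elim/ord3_ind: i; elim/ord3_ind: j.
Qed.

Lemma card_balanced : #|[set t | balanced t]%SET| =
  (\sum_(a < n.+1) \sum_(b < n.+1) \sum_(c < n.+1)
    if (a + b + c == n)%N then
      #|[set t : N.-tuple ('I_3 * 'I_3) | [forall u, count_mem u t == diagonal_mx a b c u]]%SET|
        else 0)%N.
Proof.
pose f t : 'I_n.+1 * ('I_n.+1 * 'I_n.+1) :=
  (inord (cnt t i0 i0), (inord (cnt t i0 i1), inord (cnt t i0 i2))).
rewrite -sum1dep_card (partition_big f xpredT) //=.
rewrite pair_bigA pair_bigA /=.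
rewrite [RHS](reindex (fun u : 'I_n.+1 * ('I_n.+1 * 'I_n.+1) => ((u.1, u.2.1), u.2.2))) /=;
  last first.
  by exists (fun u => (u.1.1, (u.1.2, u.2))) => [[x [y z]]|[[x y] z]].
apply: eq_bigr => -[a [b c]] _ /=; rewrite sum1dep_card.
have inordE (m : nat) (x : 'I_n.+1) : (m <= n)%N -> (inord m == x) = (m == x :> nat).
  by move=> mn; rewrite -val_eqE /= inordK.
have [le_a le_b le_c] : [/\ a <= n, b <= n & c <= n]%N by split; rewrite -ltnS.
have fE t : balanced t -> (f t == (a, (b, c))) =
    [&& cnt t i0 i0 == a, cnt t i0 i1 == b & cnt t i0 i2 == c]%N.
  rewrite balancedE => /and3P[/and3P[/eqP r0 _ _] _ _].
  by rewrite /f !xpair_eqE !inordE // -r0 ?leq_addl // -?addnA ?leq_addr // addnCA leq_addr.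
case: (boolP (a + b + c == n)%N) => [/eqP abc|abc].
  apply: eq_card => t; rewrite !inE diagonalE; apply/andP/idP => [[bt]|].
    rewrite fE //; move: bt; rewrite balancedE.
    move: (nat_of_ord a) (nat_of_ord b) (nat_of_ord c) abc => x y z.
    move: (cnt t i0 i0) (cnt t i0 i1) (cnt t i0 i2) (cnt t i1 i0) (cnt t i1 i1) (cnt t i1 i2)
      (cnt t i2 i0) (cnt t i2 i1) (cnt t i2 i2).
    clear => x1 x2 x3 x4 x5 x6 x7 x8 x9 abc.
    move=> /and3P[/and3P[/eqP e1 /eqP e2 /eqP e3] /and3P[/eqP e4 /eqP e5 /eqP e6] /and3P[/eqP e7
      /eqP e8 /eqP e9]].
    move=> /and3P[/eqP e10 /eqP e11 /eqP e12].
    by apply/and3P; split; apply/and3P; split; apply/eqP; lia.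
  move=> h; have bt : balanced t.
    move: h; rewrite balancedE; move: (nat_of_ord a) (nat_of_ord b) (nat_of_ord c) abc => x y z.
    move: (cnt t i0 i0) (cnt t i0 i1) (cnt t i0 i2) (cnt t i1 i0) (cnt t i1 i1) (cnt t i1 i2)
      (cnt t i2 i0) (cnt t i2 i1) (cnt t i2 i2).
    clear => x1 x2 x3 x4 x5 x6 x7 x8 x9 abc.
    move=> /and3P[/and3P[/eqP e1 /eqP e2 /eqP e3] /and3P[/eqP e4 /eqP e5 /eqP e6] /and3P[/eqP e7
      /eqP e8 /eqP e9]].
    by apply/and3P; split; apply/and3P; split; apply/eqP; lia.
  by split=> //; rewrite fE //; case/and3P: h.
apply/eqP; rewrite cards_eq0; apply/eqP/setP => t; rewrite !inE.
apply: contraNF abc => /andP[bt]; rewrite fE // => /and3P[/eqP <- /eqP <- /eqP <-].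
by move: bt; rewrite balancedE => /and3P[/and3P[]].
Qed.

End ThreeClasses.

Section ButsonProbability.
Variable R : realType.

Definition ord_add p (a b : 'I_p) : 'I_p :=
  Ordinal (ltn_pmod (a + b) (leq_ltn_trans (leq0n a) (ltn_ord a))).

Let ord_diff_add (x a b : 'I_3) : ord_diff (ord_add x a) (ord_add x b) = ord_diff a b.
Proof. by apply: val_inj; elim/ord3_ind: x; elim/ord3_ind: a; elim/ord3_ind: b. Qed.

Let ord_addK (x y : 'I_3) : ord_add x (ord_diff y x) = y.
Proof. by apply: val_inj; elim/ord3_ind: x; elim/ord3_ind: y. Qed.

Let ord_diff0 (x : 'I_3) : ord_diff x i0 = x.
Proof. by apply: val_inj; elim/ord3_ind: x. Qed.

Let ord_add_inj (x : 'I_3) : injective (ord_add x).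
Proof. by move=> a b; elim/ord3_ind: x; elim/ord3_ind: a; elim/ord3_ind: b. Qed.

Let p3 : prime 3. Proof. by []. Qed.
Let w := Butson_w R 3.

Variable n : nat.
Let N := (3 * n)%N.
Let code := (N.-tuple 'I_3 * N.-tuple ('I_3 * 'I_3))%type.

(* The exponents of the k-th column are x, x + a and x + b, where x is the k-th
   entry of u.1 and (a, b) that of u.2: u.2 encodes the dephased matrix. *)
Let expo (u : code) (i : 'I_3) (k : 'I_N) : 'I_3 :=
  ord_add (tnth u.1 k) (nth i0 [:: i0; (tnth u.2 k).1; (tnth u.2 k).2] i).

Let decode (u : code) : 'M[R[i]]_(3, N) := \matrix_(i, k) w ^+ expo u i k.

Let decode_inj : injective decode.
Proof.
move=> [x t] [x' t'] /matrixP E.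
have EE i k : expo (x, t) i k = expo (x', t') i k.
  by have := E i k; rewrite !mxE => /(@Butson_w_inj R 3 p3).
have add0 (y : 'I_3) : ord_add y i0 = y by apply: val_inj; elim/ord3_ind: y.
have xE k : tnth x k = tnth x' k by have := EE i0 k; rewrite /expo /= !add0.
congr (_, _); apply: eq_from_tnth => k; first exact: xE.
apply/eqP; rewrite -pair_eqE /pair_eq /=; apply/andP; split; apply/eqP.
  by have := EE i1 k; rewrite /expo /= xE => /ord_add_inj.
by have := EE i2 k; rewrite /expo /= xE => /ord_add_inj.
Qed.

Let decode_image : decode @` [set u : code | xpredT u] = @mx_unity R 3 3 N.
Proof.
apply/seteqP; split => [H [u _ <-] i k|H Hu].
  by apply/unity_rootP; rewrite mxE exprAC Butson_w_expr // expr1n.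
have ex i := @boolp.choice _ _ (fun k c => H i k = w ^+ (c : 'I_3)) (fun k => unity_rootP_Butson
  p3 (Hu i k)).
have fE i := projT2 (ex i); set f := fun i => projT1 (ex i).
have {}fE i k : H i k = w ^+ f i k by exact: fE.
exists ([tuple f i0 k | k < N], [tuple (ord_diff (f i1 k) (f i0 k), ord_diff (f i2 k) (f i0 k)) |
  k < N]) => //.
apply/matrixP => i k; rewrite mxE fE /expo /= !tnth_mktuple.
have add0 (y : 'I_3) : ord_add y i0 = y by apply: val_inj; elim/ord3_ind: y.
elim/ord3_ind: i.
- exact: (congr1 (fun y : 'I_3 => w ^+ y) (add0 _)).
- exact: (congr1 (fun y : 'I_3 => w ^+ y) (ord_addK _ _)).
- exact: (congr1 (fun y : 'I_3 => w ^+ y) (ord_addK _ _)).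
Qed.

Let decode_Butson u : partial_Butson 3 (decode u) <-> balanced u.2.
Proof.
apply: iff_trans (@partial_Butson_exponents R 3 N (decode u) (expo u) p3 _) _.
  by move=> i k; rewrite mxE.
have d1 : (fun k => ord_diff (expo u i1 k) (expo u i0 k)) = (fun k => (tnth u.2 k).1).
  by apply/funext => k; rewrite /expo ord_diff_add ord_diff0.
have d2 : (fun k => ord_diff (expo u i2 k) (expo u i0 k)) = (fun k => (tnth u.2 k).2).
  by apply/funext => k; rewrite /expo ord_diff_add ord_diff0.
have d3 : (fun k => ord_diff (expo u i2 k) (expo u i1 k)) =
    (fun k => ord_diff (tnth u.2 k).2 (tnth u.2 k).1).
  by apply/funext => k; rewrite /expo ord_diff_add.
rewrite d1 d2 d3; split => [[h1 h2 h3]|/and3P[/forallP h1 /forallP h2 /forallP h3]].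
  by apply/and3P; split; apply/forallP => c; apply/eqP; [exact: h1|exact: h2|exact: h3].
by split => c; apply/eqP; [exact: h1|exact: h2|exact: h3].
Qed.

Let Butson_image : @mx_unity R 3 3 N `&` @partial_Butson R 3 3 N =
  decode @` [set u : code | balanced u.2].
Proof.
apply/seteqP; split => [H [Hu HB]|H [u /decode_Butson uB <-]].
  move: Hu; rewrite -decode_image => -[u _ uH]; exists u => //=.
  by apply/decode_Butson; rewrite uH.
by split => //; case: uB.
Qed.

Let peak_term a b c : (a + b + c)%N = n ->
  (#|[set t : N.-tuple ('I_3 * 'I_3) | [forall u, count_mem u t == diagonal_mx a b c u]]%SET|)%:R
    / 9 ^+ N = trinomial_peak R n 0 * trinomial R n a b c ^+ 3.
Proof.
move=> abc.
have big9 (S : Type) (idx : S) (op : Monoid.com_law idx) (F : 'I_3 * 'I_3 -> S) :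
    \big[op/idx]_u F u = op (op (F (i0, i0)) (op (F (i0, i1)) (F (i0, i2))))
      (op (op (F (i1, i0)) (op (F (i1, i1)) (F (i1, i2))))
        (op (F (i2, i0)) (op (F (i2, i1)) (F (i2, i2))))).
  have big3 (G : 'I_3 -> S) : \big[op/idx]_i G i = op (G i0) (op (G i1) (G i2)).
    rewrite !big_ord_recl big_ord0 Monoid.mulm1.
    by congr (op (G _) (op (G _) (G _))); apply: val_inj.
  transitivity (\big[op/idx]_i \big[op/idx]_j F (i, j)); last by rewrite !big3.
  by rewrite (pair_bigA _ (fun i j => F (i, j))); apply: eq_bigr => -[i j].
have := @multinomial_count ('I_3 * 'I_3)%type N (diagonal_mx a b c).
rewrite !big9 /diagonal_mx /= => /(_ ltac:(rewrite /N -abc; lia)).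
rewrite -/(diagonal_mx a b c); set K := #|_| => KE.
have {}KE : (K%:R * (a`!%:R * b`!%:R * c`!%:R) ^+ 3 = N`!%:R :> R).
  by rewrite -KE !natrM; ring.
have f0 i : i`!%:R != 0 :> R by rewrite pnatr_eq0 -lt0n fact_gt0.
have t0 i : 3 ^+ i != 0 :> R by rewrite expf_neq0 // pnatr_eq0.
rewrite /trinomial_peak /trinomial abc eqxx addn0 expr0 mulr1 -/N -KE.
have -> : 9 ^+ N = 3 ^+ N * (3 ^+ n) ^+ 3 :> R.
  by rewrite -exprM [(n * 3)%N]mulnC -/N -exprMn; congr (_ ^+ _); ring.
move: (f0 a) (f0 b) (f0 c) (f0 n) (t0 N) (t0 n).
move: (K%:R) (a`!%:R) (b`!%:R) (c`!%:R) (n`!%:R) (3 ^+ N) (3 ^+ n).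
move=> k x y z f s r h1 h2 h3 h4 h5 h6.
by field; rewrite ?h1 ?h2 ?h3 ?h4 ?h5 ?h6.
Qed.

Lemma Butson_proba3 :
  Butson_proba R 3 3 (3 * n) = trinomial_peak R n 0 * trinomial_cube_sum R n.
Proof.
rewrite /Butson_proba /uniform_proba -/N Butson_image -decode_image !card_fset_set_image //.
have -> : #|(fun u : code => balanced u.2)| = (3 ^ N * #|[set t : N.-tuple ('I_3 * 'I_3) |
  balanced t]%SET|)%N.
  have <- : #|{: N.-tuple 'I_3}| = (3 ^ N)%N by rewrite card_tuple card_ord.
  by rewrite -cardX; apply: eq_card => -[x t]; rewrite !inE.
have -> : #|(fun u : code => xpredT u)| = (3 ^ N * 9 ^ N)%N.
  rewrite (_ : #|_| = #|{: code}|); last exact: eq_card.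
  by rewrite card_prod !card_tuple card_prod !card_ord.
rewrite (@card_balanced N n) // !natrM invfM mulrACA divff ?mul1r ?natrX ?expf_neq0 ?pnatr_eq0 //.
rewrite natr_sum mulr_suml /trinomial_cube_sum mulr_sum3r; apply: eq_bigr => a _.
rewrite natr_sum mulr_suml; apply: eq_bigr => b _.
rewrite natr_sum mulr_suml; apply: eq_bigr => c _.
case: eqP => [abc|abc]; first exact: peak_term.
by rewrite /trinomial; case: eqP => // _; rewrite mul0r expr0n mulr0.
Qed.

End ButsonProbability.

Theorem theoremC (R : realType) :
  (forall p N : nat, prime p -> (1 <= N)%N ->
    [/\ forall H : 'M[R[i]]_(3, N), mx_unity p H -> dephased H ->
          (partial_Butson p H <->
           tristochastic (N%:R / p%:R) (multiplicity_mx p H)),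
        (@multiplicity_mx R p N) @`
            [set H : 'M[R[i]]_(3, N) | dephased H /\ partial_Butson p H]
          = @tristochastic p (N%:R / p%:R)
      & forall H H' : 'M[R[i]]_(3, N),
          dephased H -> partial_Butson p H ->
          dephased H' -> partial_Butson p H' ->
          (multiplicity_mx p H = multiplicity_mx p H' <->
           exists s : 'S_N, H' = col_perm s H)])
  /\
  ((fun n : nat =>
      Butson_proba R 3 3 (3 * n)
        / (243 * Num.sqrt 3 / (2 * pi * (3 * n)%:R) ^+ 3)) @ \oo --> (1 : R)).
Proof.
split=> [p N pp _|].
  split; [exact: dephased_criterion|exact: multiplicity_mx_image|exact: multiplicity_mx_perm].
set c : R := 9 * Num.sqrt 3 / (8 * pi ^+ 3).
have c0 : c != 0.
  have := lt0r_neq0 (pi_gt0 R) => pi0.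
  by rewrite mulf_neq0 ?invr_eq0 ?mulf_neq0 ?expf_neq0 ?sqrtr_eq0 -?ltNge.
have : (fun n : nat => n%:R ^+ 3 * (trinomial_peak R n 0 * trinomial_cube_sum R n) * c^-1) @ \oo
    --> c * c^-1.
  by apply: cvgM; [exact: trinomial_peak_cube_sum_cvg|exact: cvg_cst].
rewrite divff //; apply: cvg_trans; apply: near_eq_cvg; near=> n.
have n0 : n%:R != 0 :> R by rewrite pnatr_eq0 -lt0n; near: n; exact: nbhs_infty_gt.
rewrite Butson_proba3 /c natrM.
move: (trinomial_peak R n 0 * trinomial_cube_sum R n) => P.
have s0 : Num.sqrt 3 != 0 :> R by rewrite sqrtr_eq0 -ltNge.
move: (@pi R) (lt0r_neq0 (pi_gt0 R)) (Num.sqrt 3) s0 n%:R n0 => q q0 s s0 x x0.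
by field; rewrite q0 s0 x0.
Unshelve. all: by end_near.
Qed.
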